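(* Let $G$ be a countable group with no finitely generated subgroup of exponential growth. Then for every continuous action $\rho$ of $G$ on a compact connected one-manifold $M$ there exists a $C^1$ action $\hat\rho$ of $G$ (that is, an action by $C^1$ diffeomorphisms) on $M$ that is semi-conjugate to $\rho$.
   Context: A finitely generated group $H$ with finite symmetric generating set $S$ containing the identity has exponential growth if $\lim_{n\to\infty}|S^n|^{1/n}>1$, where $S^n=\{s_1\cdots s_n : s_j\in S\}$ (this does not depend on $S$); otherwise it has subexponential growth. A compact connected one-manifold is a compact interval or the circle. A continuous action of $G$ on $M$ is a homomorphism $\rho\colon G\to\mathrm{Homeo}(M)$. For two such actions $\hat\rho,\rho$ on $M$, $\hat\rho$ is a blow-up of $\rho$ if there exists a continuous surjective map $h\colon M\to M$ such that $h^{-1}(J)$ is connected for every connected set $J\subseteq M$, and such that $h\circ\hat\rho(g)=\rho(g)\circ h$ for every $g\in G$. Semi-conjugacy is the equivalence relation on continuous actions of $G$ on $M$ generated by the pairs $(\hat\rho,\rho)$ such that $\hat\rho$ is a blow-up of $\rho$; in particular, a blow-up of $\rho$ is semi-conjugate to $\rho$. *)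

(* Defs.v *)
From HB Require Import structures.
From mathcomp Require Import all_boot all_order all_algebra finmap.
From mathcomp Require Import all_classical all_reals all_analysis.
From Stdlib Require Export Relation_Operators.

Set Implicit Arguments.
Unset Strict Implicit.
Unset Printing Implicit Defensive.

Import Order.TTheory GRing.Theory Num.Theory.
Import numFieldNormedType.Exports.

Local Open Scope classical_set_scope.
Local Open Scope ring_scope.

Section Growth.
Local Open Scope group_scope.
Variable G : groupType.
Implicit Types (H : set G) (S : {fset G}).

Definition is_subgroup H : Prop := group_closed (mem H).

Definition generated_subgroup S : set G := smallest is_subgroup [set` S].

Definition finitely_generated H : Prop := exists S, generated_subgroup S = H.

Fixpoint fset_power S (n : nat) : {fset G} :=
  if n is n'.+1 then [fset s * x | s in S, x in fset_power S n']%fset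
  else [fset 1]%fset.

Definition symmetric_fset S : Prop := forall s, s \in S -> s^-1 \in S.

(* The limit always exists and whether it exceeds 1 does not depend on S, so
   [exists S] could equivalently be [forall S]. *)
Definition exponential_growth (R : realType) H : Prop :=
  exists S, [/\ symmetric_fset S, 1 \in S, generated_subgroup S = H &
    exists2 l : R, (1 < l)%R &
      (#|` fset_power S n|%:R `^ n%:R^-1)%R @[n --> \oo] --> l].

End Growth.

Section Actions.
Variable M : topologicalType.

Definition homeomorphism (f : M -> M) : Prop :=
  exists g : M -> M, [/\ cancel f g, cancel g f, continuous f & continuous g].

Variable G : groupType.

Record action := Action {
  act :> G -> M -> M;
  act_homeo : forall g, homeomorphism (act g);
  actM : forall g h, act (g * h)%g = act g \o act h
}.

Definition blow_up (rho' rho : action) : Prop :=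
  exists h : M -> M, [/\ continuous h,
    set_surj setT setT h,
    forall J : set M, connected J -> connected (h @^-1` J) &
    forall g, h \o rho' g = rho g \o h].

Definition semi_conjugate : action -> action -> Prop :=
  clos_refl_sym_trans action blow_up.

End Actions.

Section OneManifolds.
Variable R : realType.

Definition circle : set (R * R) := [set p | p.1 ^+ 2 + p.2 ^+ 2 = 1].

Fact cos_sin_circle (t : R) : (cos t, sin t) \in circle.
Proof. by apply/mem_set; rewrite /circle /= cos2Dsin2. Qed.

Definition circle_point (t : R) : circle :=
  exist (fun p => p \in circle) (cos t, sin t) (cos_sin_circle t).

Inductive one_manifold : Type :=
| Interval (a b : R) of a < b
| Circle.

Definition carrier (M : one_manifold) : topologicalType :=
  match M with
  | Interval a b _ => `[a, b]%classic : topologicalType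
  | Circle => circle : topologicalType
  end.

(* At an endpoint the difference quotient runs over points of [a, b] only, so
   the derivative is one-sided there. *)
Definition C1_itv (a b : R) (f : `[a, b]%classic -> `[a, b]%classic) : Prop :=
  exists2 f' : `[a, b]%classic -> R, continuous f' &
    forall x : `[a, b]%classic,
      (set_val y - set_val x)^-1 * (set_val (f y) - set_val (f x)) @[y --> x^']
        --> f' x.

(* t |-> (cos t, sin t) is a local diffeomorphism from the line onto the circle
   and the circle is a submanifold of the plane, so f is C^1 iff the plane curve
   t |-> f (cos t, sin t) is. *)
Definition C1_circle (f : circle -> circle) : Prop :=
  let F (t : R) : R * R := set_val (f (circle_point t)) in
  (forall t, derivable F t 1) /\ continuous (derive1 F).

Definition C1 (M : one_manifold) : (carrier M -> carrier M) -> Prop :=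
  match M with
  | Interval a b _ => @C1_itv a b
  | Circle => C1_circle
  end.

Definition C1_diffeomorphism (M : one_manifold) (f : carrier M -> carrier M) :
    Prop :=
  exists g : carrier M -> carrier M, [/\ cancel f g, cancel g f, C1 f & C1 g].

Definition C1_action (M : one_manifold) (G : groupType)
    (rho : action (carrier M) G) : Prop :=
  forall g, C1_diffeomorphism (rho g).

End OneManifolds.

(* Main.v *)
Require Import Defs.
From HB Require Import structures.
From mathcomp Require Import all_boot all_order all_algebra.
From mathcomp Require Import all_classical all_reals all_analysis.
From mathcomp Require Import finmap ring lra.

(** The action is smoothed by a Denjoy construction. A countable dense set of
points of the manifold, invariant under the group, is chosen together with
weights [w p > 0] on it, of finite total mass and with [w p / w (g p)] close
to [1] for all but finitely many [p], for each element [g] of the group. Every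
point [p] is then replaced by a closed interval, its gap, of length [2 w p],
and the total mass is such that the manifold obtained has the same length as
the original one. What remains outside the gaps is a set without length, so
that lengths are sums of lengths of gaps. Collapsing the gaps is the map which
exhibits the new action as a blow-up of the original one.

It remains to let [g] map the gap of [p] onto the gap of [g p]. The maps
[gap_map a b] from [[-a, a]] onto [[-b, b]] are odd, compose like the pairs
[(a, b)] ([gap_map_comp]), which makes the construction functorial, have
derivative [1] at both ends, and have derivative uniformly close to [1] when
[b / a] is close to [1] ([gap_deriv_bound]). The derivative of the new map is
therefore declared to be [1] outside the gaps, up to the sign of the
orientation. This function is continuous since only finitely many gaps carry a
derivative which is not almost [1] ([blown_deriv_continuous]), and it is the
derivative of the new map since bounds on it integrate to bounds on increments:
both sides of the inequality are sums over gaps ([blown_map_incr_bound]).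

The weights come from the growth hypothesis. For the finite symmetric sets
[S 0], [S 1], etc., increasing to the group, the number of elements of [S k ^ j]
is at most [C mu ^ j] for every [mu > 1] ([subexponential_bound], by the
subadditivity lemma of Fekete). Put
[w p = sup {c k (1 + 1 / (k + 1)) ^ -j : p = s x_i, s in S k ^ j, i <= k}] for a
dense sequence [x]. For [k] large the elements of [S k] change the terms of
index [k] by a factor close to [1], while far away the terms of index [k] are
dominated by those of any larger index, whose decay in [j] is slower
([tempered_weight]).

The interval and the circle are treated together as quotients of an interval
[I] of the line by a translation group, which is trivial for the interval:
[blown_up_action] carries out the construction for lifts of the
homeomorphisms to [I], which are monotone bijections. *)

Set Implicit Arguments.
Unset Strict Implicit.
Unset Printing Implicit Defensive.

Import Order.TTheory GRing.Theory Num.Theory.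
Import numFieldNormedType.Exports.

Local Open Scope classical_set_scope.
Local Open Scope ring_scope.

(** * Maps between gaps of different lengths *)

Section Gap.
Variable R : realType.
Implicit Types a b r s q y lo hi : R.

(** The diffeomorphisms [yoccoz r] of [[-1, 1]], for [r > 0], form a
one-parameter group under composition; they are the flow of a vector field
which vanishes at [0] and at both ends, with the same derivative at the two
ends, so that their derivatives at [1] and at [-1] are equal to [1 / r].
The factor is a function of the square [q] of the variable. *)
Definition yoccoz_factor r q := Num.sqrt (r / (1 + (r - 1) * q)).

Definition yoccoz r y := y * yoccoz_factor r (y ^+ 2).

Lemma yoccoz_den_gt0 r q : 0 < r -> 0 <= q <= 1 -> 0 < 1 + (r - 1) * q.
Proof.
move=> r0 /andP[q0]; rewrite le_eqVlt => /predU1P[->|q1]; first lra.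
have := mulr_ge0 (ltW r0) q0; lra.
Qed.

Lemma yoccoz_factor_gt0 r q : 0 < r -> 0 <= q <= 1 -> 0 < yoccoz_factor r q.
Proof. by move=> r0 q01; rewrite sqrtr_gt0 divr_gt0// yoccoz_den_gt0. Qed.

Lemma yoccoz_factor_sqr r q : 0 < r -> 0 <= q <= 1 ->
  yoccoz_factor r q ^+ 2 = r / (1 + (r - 1) * q).
Proof. by move=> r0 q01; rewrite sqr_sqrtr// divr_ge0 ?ltW// yoccoz_den_gt0. Qed.

Lemma yoccoz_factor_at1 r : 0 < r -> yoccoz_factor r 1 = 1.
Proof.
by move=> r0; rewrite /yoccoz_factor mulr1 addrC subrK divff ?sqrtr1 ?gt_eqF.
Qed.

Lemma yoccoz_factor1 q : yoccoz_factor 1 q = 1.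
Proof. by rewrite /yoccoz_factor subrr mul0r addr0 divr1 sqrtr1. Qed.

Lemma yoccoz1 y : yoccoz 1 y = y.
Proof. by rewrite /yoccoz yoccoz_factor1 mulr1. Qed.

Lemma yoccozN r y : yoccoz r (- y) = - yoccoz r y.
Proof. by rewrite /yoccoz sqrrN mulNr. Qed.

Lemma yoccoz_sqr r y : 0 < r -> y ^+ 2 <= 1 ->
  yoccoz r y ^+ 2 = y ^+ 2 * r / (1 + (r - 1) * y ^+ 2).
Proof.
by move=> r0 y1; rewrite exprMn yoccoz_factor_sqr ?sqr_ge0 ?y1// mulrA.
Qed.

Lemma yoccoz_sqr_le1 r y : 0 < r -> y ^+ 2 <= 1 -> yoccoz r y ^+ 2 <= 1.
Proof.
move=> r0 y1; rewrite yoccoz_sqr// ler_pdivrMr ?yoccoz_den_gt0 ?sqr_ge0 ?y1//.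
lra.
Qed.

Lemma yoccozM r r' y : 0 < r -> 0 < r' -> y ^+ 2 <= 1 ->
  yoccoz r' (yoccoz r y) = yoccoz (r' * r) y.
Proof.
move=> r0 r'0 y1; have y01 : 0 <= y ^+ 2 <= 1 by rewrite sqr_ge0.
have d0 := yoccoz_den_gt0 r0 y01.
have d'0 := yoccoz_den_gt0 (mulr_gt0 r'0 r0) y01.
have z1 := yoccoz_sqr_le1 r0 y1.
have z01 : 0 <= yoccoz r y ^+ 2 <= 1 by rewrite sqr_ge0.
have := yoccoz_den_gt0 r'0 z01.
rewrite yoccoz_sqr// => e0.
rewrite -[LHS]/(y * yoccoz_factor r (y ^+ 2) * yoccoz_factor r' (yoccoz r y ^+ 2)).
rewrite -[RHS]/(y * yoccoz_factor (r' * r) (y ^+ 2)) -mulrA yoccoz_sqr//.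
congr (_ * _).
rewrite /yoccoz_factor -sqrtrM; last by rewrite divr_ge0 ?ltW.
congr Num.sqrt; field.
by rewrite !gt_eqF.
Qed.

Lemma is_derive_yoccoz r y : 0 < r -> y ^+ 2 <= 1 ->
  is_derive y 1 (yoccoz r) (yoccoz_factor r (y ^+ 2) ^+ 3 / r).
Proof.
move=> r0 y1; have y01 : 0 <= y ^+ 2 <= 1 by rewrite sqr_ge0.
have d0 := yoccoz_den_gt0 r0 y01.
have s0 := yoccoz_factor_gt0 r0 y01.
have s2 := yoccoz_factor_sqr r0 y01.
set d := 1 + _ in d0 s2.
set s := yoccoz_factor _ _ in s0 s2 *.
have dd : is_derive y 1 (fun y => r / (1 + (r - 1) * y ^+ 2))
    (- 2 * r * (r - 1) * y / d ^+ 2).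
  have d1 : is_derive y 1 (fun y => 1 + (r - 1) * y ^+ 2) (2 * (r - 1) * y).
    have H := is_deriveD (is_derive_cst (1 : R) y 1) (is_deriveM
      (is_derive_cst (r - 1) y 1) (is_deriveX 2 (is_derive_id y 1))).
    by apply: is_derive_eq H _; rewrite /GRing.scale/= /cst/=; ring.
  have dn0 : 1 + (r - 1) * y ^+ 2 != 0 by rewrite gt_eqF.
  have H := is_deriveM (is_derive_cst r y 1) 
    (@is_deriveV _ (fun y => 1 + (r - 1) * y ^+ 2) _ _ _ dn0 d1).
  by apply: is_derive_eq H _; rewrite /GRing.scale/= /cst/= -/d; field; rewrite gt_eqF.
have dq : is_derive y 1 (fun y => yoccoz_factor r (y ^+ 2))
    ((2 * s)^-1 * (- 2 * r * (r - 1) * y / d ^+ 2)).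
  apply: (@is_derive1_comp _ Num.sqrt (fun y => r / (1 + (r - 1) * y ^+ 2))).
  by apply: is_derive1_sqrt; rewrite divr_gt0.
have H := is_deriveM (is_derive_id y 1) dq.
apply: is_derive_eq H _; rewrite /GRing.scale/= -/s mulr1.
have -> : d ^+ 2 = r ^+ 2 / s ^+ 4.
  by rewrite (exprM s 2 2) s2; field; rewrite !gt_eqF.
apply/eqP; rewrite -subr_eq0.
rewrite (_ : _ - _ = s * (1 - s ^+ 2 * d / r)); last first.
  by rewrite /d; field; rewrite !gt_eqF.
by rewrite s2 (divfK (lt0r_neq0 d0)) (divff (lt0r_neq0 r0)) subrr mulr0.
Qed.

Lemma yoccoz_factor_bound r q e : 0 < e -> 0 < r -> 0 <= q <= 1 ->
    r <= 1 + e -> 1 <= (1 + e) * r ->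
  yoccoz_factor r q <= 1 + e /\ 1 <= (1 + e) * yoccoz_factor r q.
Proof.
move=> e0 r0 q01 re er.
have d0 := yoccoz_den_gt0 r0 q01.
have s0 := yoccoz_factor_gt0 r0 q01.
have s2 := yoccoz_factor_sqr r0 q01.
have /andP[q0 q1] := q01.
split.
  have e1 : 0 <= 1 + e by lra.
  rewrite -(@ler_pXn2r _ 2) ?nnegrE ?(ltW s0)//.
  rewrite s2 ler_pdivrMr//.
  have q1' : 0 <= 1 - q by lra.
  have rq : 0 <= r * q by apply: mulr_ge0 => //; exact: ltW.
  have : r <= (1 + e) ^+ 2 * (1 - q) + (1 + e) ^+ 2 * r * q.
    have h1 : r * (1 - q) <= (1 + e) ^+ 2 * (1 - q).
      apply: ler_wpM2r => //; rewrite expr2; nra.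
    have h2 : r * q <= (1 + e) ^+ 2 * (r * q).
      by rewrite ler_peMl// expr2; nra.
    by rewrite -mulrA; lra.
  by move/le_trans; apply; rewrite le_eqVlt; apply/orP; left; apply/eqP; ring.
have e1 : 0 <= (1 + e) * yoccoz_factor r q by rewrite mulr_ge0 ?(ltW s0)//; lra.
rewrite -(@ler_pXn2r _ 2) ?nnegrE//.
rewrite expr1n exprMn s2 mulrA ler_pdivlMr// mul1r.
have e2 : 1 <= (1 + e) ^+ 2 by rewrite expr2; nra.
have h1 : (1 - q) <= (1 + e) ^+ 2 * r * (1 - q).
  by rewrite ler_peMl//; [lra|rewrite expr2 -mulrA; nra].
have h2 : r * q <= (1 + e) ^+ 2 * (r * q).
  by rewrite ler_peMl// mulr_ge0// (ltW r0).
lra.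
Qed.

(** The map from [[-a, a]] onto [[-b, b]] conjugate to [yoccoz (b / a)] by
rescaling. At the ends the derivative [b / a] of the rescaling cancels the
derivative [a / b] of [yoccoz (b / a)]. *)
Definition gap_map a b s := b * yoccoz (b / a) (s / a).

(** The derivative of [gap_map a b], extended by [1] outside [[-a, a]] by
truncating the square of [s / a], and equal to [1] for a degenerate gap. *)
Definition gap_deriv a b s :=
  if a == 0 then 1 else yoccoz_factor (b / a) (Num.min ((s / a) ^+ 2) 1) ^+ 3.

Lemma sqr_div_le1 a s : `|s| <= a -> (s / a) ^+ 2 <= 1.
Proof.
move=> sa; have [->|an0] := eqVneq a 0; first by rewrite invr0 mulr0 expr0n.
have a0 : 0 < a by rewrite lt0r an0 (le_trans (normr_ge0 _) sa).
rewrite -real_normK ?num_real// expr_le1// normf_div (gtr0_norm a0).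
by rewrite ler_pdivrMr// mul1r.
Qed.

Lemma gap_mapN a b s : gap_map a b (- s) = - gap_map a b s.
Proof. by rewrite /gap_map mulNr yoccozN mulrN. Qed.

Lemma gap_map_le a b s : 0 < a -> 0 < b -> `|s| <= a -> `|gap_map a b s| <= b.
Proof.
move=> a0 b0 sa; rewrite /gap_map normrM (gtr0_norm b0) ger_pMr//.
rewrite -(@expr_le1 _ 2)// real_normK ?num_real// yoccoz_sqr_le1//.
  exact: divr_gt0.
exact: sqr_div_le1.
Qed.

Lemma gap_map0 b s : gap_map 0 b s = 0.
Proof. by rewrite /gap_map /yoccoz invr0 mulr0 mul0r mulr0. Qed.

Lemma gap_map_id a s : 0 < a -> gap_map a a s = s.
Proof.
by move=> a0; rewrite /gap_map divff ?gt_eqF// yoccoz1 mulrC divfK ?gt_eqF.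
Qed.

Lemma gap_map_comp a b c s : 0 < a -> 0 < b -> 0 < c -> `|s| <= a ->
  gap_map b c (gap_map a b s) = gap_map a c s.
Proof.
move=> a0 b0 c0 sa; rewrite /gap_map; congr (_ * _).
rewrite (mulrC b) mulfK ?gt_eqF// yoccozM ?divr_gt0 ?sqr_div_le1//.
by congr yoccoz; field; rewrite !gt_eqF.
Qed.

Lemma gap_map_end a b : 0 < a -> 0 < b -> gap_map a b a = b.
Proof.
move=> a0 b0; rewrite /gap_map /yoccoz divff ?gt_eqF// expr1n.
by rewrite yoccoz_factor_at1 ?divr_gt0// !mulr1.
Qed.

Lemma is_derive_gap_map a b s : 0 < a -> 0 < b -> `|s| <= a ->
  is_derive s 1 (gap_map a b) (gap_deriv a b s).
Proof.
move=> a0 b0 sa; have s1 := sqr_div_le1 sa.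
have r0 : 0 < b / a by rewrite divr_gt0.
have d1 : is_derive s 1 (fun s => s / a) (a^-1).
  have H := is_deriveM (is_derive_id s 1) (is_derive_cst a^-1 s 1).
  by apply: is_derive_eq H _; rewrite /GRing.scale/= mulr0 add0r mulr1.
have d2 := @is_derive1_comp _ (yoccoz (b / a)) (fun s => s / a) s _ _
  (is_derive_yoccoz r0 s1) d1.
have H := is_deriveM (is_derive_cst b s 1) d2.
apply: is_derive_eq H _.
rewrite /GRing.scale/= mulr0 addr0 /gap_deriv gt_eqF//.
rewrite min_l//; field; rewrite !gt_eqF//.
Qed.

Lemma gap_deriv_out a b s : 0 <= a -> (0 < a -> 0 < b) -> a <= `|s| ->
  gap_deriv a b s = 1.
Proof.
rewrite /gap_deriv le_eqVlt => /predU1P[<-|a0 /(_ a0) b0 sa].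
  by rewrite eqxx.
rewrite gt_eqF// min_r ?yoccoz_factor_at1 ?divr_gt0 ?expr1n//.
rewrite -real_normK ?num_real// expr_ge1// normf_div (gtr0_norm a0).
by rewrite ler_pdivlMr// mul1r.
Qed.

Lemma gap_deriv_gt0 a b s : 0 <= a -> (0 < a -> 0 < b) -> 0 < gap_deriv a b s.
Proof.
rewrite /gap_deriv le_eqVlt => /predU1P[<-|a0 /(_ a0) b0]; first by rewrite eqxx.
rewrite gt_eqF// exprn_gt0// yoccoz_factor_gt0 ?divr_gt0//.
by rewrite le_min sqr_ge0 ler01 ge_min lexx orbT.
Qed.

Lemma gap_deriv_bound a b s e : 0 < e <= 1 -> 0 < a -> 0 < b ->
  a <= (1 + e) * b -> b <= (1 + e) * a -> `|gap_deriv a b s - 1| <= 7 * e.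
Proof.
move=> /andP[e0 e1] a0 b0 ab ba; rewrite /gap_deriv gt_eqF//.
set q := Num.min _ _; set t := yoccoz_factor _ _.
have q01 : 0 <= q <= 1 by rewrite le_min sqr_ge0 ler01 ge_min lexx orbT.
have [t1 t2] : t <= 1 + e /\ 1 <= (1 + e) * t.
  apply: yoccoz_factor_bound => //; first exact: divr_gt0.
    by rewrite ler_pdivrMr.
  by rewrite mulrA ler_pdivlMr// mul1r.
have t0 : 0 < t by apply: yoccoz_factor_gt0; rewrite ?divr_gt0.
have e3 : (1 + e) ^+ 3 <= 1 + 7 * e.
  rewrite !exprS expr0; nra.
have t3 : t ^+ 3 <= (1 + e) ^+ 3.
  by rewrite ler_pXn2r// nnegrE ltW//; lra.
have t4 : 1 <= (1 + e) ^+ 3 * t ^+ 3.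
  by rewrite -exprMn expr_ge1//; lra.
rewrite ler_norml; apply/andP; split; last lra.
have t30 : 0 < t ^+ 3 by rewrite exprn_gt0.
have h : 1 <= (1 + 7 * e) * t ^+ 3.
  by apply: (le_trans t4); apply: ler_wpM2r => //; exact: ltW.
nra.
Qed.

Lemma gap_deriv_continuous a b : 0 <= a -> (0 < a -> 0 < b) ->
  continuous (gap_deriv a b).
Proof.
rewrite le_eqVlt => /predU1P[<- _|a0 /(_ a0) b0] s; rewrite /gap_deriv.
  by rewrite eqxx; exact: cvg_cst.
rewrite gt_eqF//.
pose q t := Num.min ((t / a) ^+ 2) 1.
have q01 t : 0 <= q t <= 1.
  by rewrite le_min sqr_ge0 ler01 ge_min lexx orbT.
have qc : continuous q.
  move=> t; have c1 : {for t, continuous (fun t : R => t / a)}.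
    by apply: cvgM; [exact: cvg_id|exact: cvg_cst].
  have c2 : {for t, continuous (fun _ : R => 1 : R)} by exact: cvg_cst.
  exact: continuous_min (continuous_comp c1 (@exprn_continuous _ 2 _)) c2.
have dc : {for s, continuous (fun t : R => b / a / (1 + (b / a - 1) * q t))}.
  apply: cvgM; first exact: cvg_cst.
  apply: cvgV; first by rewrite gt_eqF// yoccoz_den_gt0 ?divr_gt0.
  apply: cvgD; first exact: cvg_cst.
  by apply: cvgM; [exact: cvg_cst|exact: qc].
have fc := continuous_comp dc (@sqrt_continuous _ _).
exact: continuous_comp fc (@exprn_continuous _ 3 _).
Qed.

(** The case of a degenerate gap holds because [s1 = s2 = 0]. *)
Lemma gap_map_incr_bound a b lo hi s1 s2 : 0 <= a -> (0 < a -> 0 < b) ->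
    - a <= s1 -> s1 <= s2 -> s2 <= a ->
    (forall s, s1 <= s <= s2 -> lo <= gap_deriv a b s <= hi) ->
  lo * (s2 - s1) <= gap_map a b s2 - gap_map a b s1 <= hi * (s2 - s1).
Proof.
rewrite le_eqVlt => /predU1P[<- _ h1 h2 h3 _|a0 /(_ a0) b0 h1 h2 h3 H].
  have -> : s1 = 0 by lra.
  have -> : s2 = 0 by lra.
  by rewrite !subrr !mulr0 lexx.
have dv s : s1 <= s <= s2 -> is_derive s 1 (gap_map a b) (gap_deriv a b s).
  move=> /andP[? ?]; apply: is_derive_gap_map => //; rewrite ler_norml; lra.
have [s|s|s sI ->] := @MVT_segment _ (gap_map a b) (gap_deriv a b) s1 s2 h2.
- rewrite in_itv/= => /andP[? ?]; apply: dv; rewrite !ltW//.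
- move: s; apply: derivable_within_continuous => s; rewrite in_itv/= => sI.
  by have [] := dv _ sI.
- move: sI; rewrite in_itv/= => /H /andP[lod dhi].
  by rewrite !ler_wpM2r ?subr_ge0.
Qed.

End Gap.

(** * Blowing up a family of points of the line *)

(** The point [x] of [I] is blown up to the segment of centre [C x] and half-length
[m x], its gap; [m x = 0] for all points but countably many. The distance
between the gaps of [x] and [y] is the total length of the gaps of the points
between [x] and [y]. *)
Record gap_spacing (R : realType) (I : set R) (m C : R -> R) : Prop :=
  GapSpacing {
  gs_itv : is_interval I;
  gs_ge0 : forall x, 0 <= m x;
  gs_dist : forall x y, I x -> I y -> x < y ->
    (C y - C x - m x - m y)%:E = \esum_(t in `]x, y[) (2 * m t)%:E;
  gs_dense : forall x y, I x -> I y -> x < y -> exists2 p, x < p < y & 0 < m p }.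

Lemma gap_lt (R : realType) (I : set R) (m C : R -> R) x y :
  gap_spacing I m C -> I x -> I y -> x < y -> C x + m x < C y - m y.
Proof.
move=> gs Ix Iy xy; have [p /andP[xp py] p0] := gs_dense gs Ix Iy xy.
suff : (0%:E < (C y - C x - m x - m y)%:E)%E by rewrite lte_fin; lra.
rewrite (gs_dist gs Ix Iy xy); apply: (@lt_le_trans _ _ (2 * m p)%:E).
  by rewrite lte_fin; lra.
apply: esum_ge; exists [set p]; last by rewrite fsbig_set1.
by split => // t ->/=; rewrite in_itv/= xp.
Qed.

(** The gaps of the points of [I] moreover cover [I], and are contained in it, so
that the blown up interval is again [I]. *)
Record gap_system (R : realType) (I : set R) (m C : R -> R) : Prop :=
  GapSystem {
  gs_spacing :> gap_spacing I m C;
  gs_cover : forall u, I u -> exists2 x, I x & `|u - C x| <= m x;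
  gs_stable : forall x u, I x -> `|u - C x| <= m x -> I u }.

(** A bijection of [I] which is strictly increasing if [sg = 1] and strictly
decreasing if [sg = -1]. *)
Record monotone_bij (R : realType) (I : set R) (sg : R) (f : R -> R) : Prop :=
  MonotoneBij {
  mb_sign : sg = 1 \/ sg = -1;
  mb_fun : forall x, I x -> I (f x);
  mb_surj : forall y, I y -> exists2 x, I x & f x = y;
  mb_mono : forall x y, I x -> I y -> x < y -> 0 < sg * (f y - f x) }.

(** [f] preserves the set of points whose gap is not degenerate, and near every point
of [I] the half-lengths of the gaps of [p] and of [f p] have a ratio close to [1]
for all but finitely many of these points [p]. *)
Record tame (R : realType) (I : set R) (m : R -> R) (f : R -> R) : Prop := Tame {
  tame_pos : forall x, I x -> (0 < m x) = (0 < m (f x));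
  tame_ratio : forall x0 e, I x0 -> 0 < e -> exists2 d, 0 < d &
    finite_set [set p | [/\ I p, `|p - x0| < d, 0 < m p &
      ~ (m p <= (1 + e) * m (f p) /\ m (f p) <= (1 + e) * m p)]] }.

Lemma esum_le_scale (R : realType) (T : choiceType) (D : set T) (g g' : T -> R)
    (c A B : R) : (forall t, 0 <= g t) ->
    (forall t, D t -> g' t <= c * g t) -> 0 <= c ->
    A%:E = \esum_(t in D) (g t)%:E -> B%:E = \esum_(t in D) (g' t)%:E ->
  B <= c * A.
Proof.
move=> g0 gg' c0 eA eB; rewrite -lee_fin eB.
apply: ge_ereal_sup => _ [X [finX XD] <-].
have XA : (\sum_(t \in X) (g t)%:E <= A%:E)%E.
  by rewrite eA; apply: ereal_sup_ubound; exists X.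
apply: (@le_trans _ _ (c%:E * \sum_(t \in X) (g t)%:E)%E).
  rewrite ge0_mule_fsumr//.
  by apply: lee_fsum => // t Xt; rewrite -EFinM lee_fin gg'//; exact: XD.
rewrite EFinM; apply: lee_pmul => //.
by apply: fsume_ge0 => t _; rewrite lee_fin.
Qed.

(** Finitely many conditions which hold for small [s] hold simultaneously for
small [s]. *)
Lemma finite_common_radius (R : realType) (P : set R) (Q : R -> R -> Prop) :
    finite_set P ->
    (forall p, P p -> exists2 d, 0 < d & forall s, s < d -> Q p s) ->
  exists2 d, 0 < d & forall p s, P p -> s < d -> Q p s.
Proof.
move=> /finite_seqP[r ->]; elim: r => [|p r IH] H.
  by exists 1.
have [|d d0 Hd] := IH; first by move=> q qr; apply: H; rewrite /= inE qr orbT.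
have [|d' d'0 Hd'] := H p; first by rewrite /= inE eqxx.
exists (Num.min d d'); first by rewrite lt_min d0.
move=> q s /=; rewrite inE lt_min => /orP[/eqP->|qr] /andP[? ?]; first exact: Hd'.
exact: Hd.
Qed.

Section Line.
Variables (R : realType) (I : set R) (m C : R -> R).
Hypothesis gs : gap_system I m C.

Let m0 := gs_ge0 gs.

Lemma gap_uniq x y u : I x -> I y -> `|u - C x| <= m x -> `|u - C y| <= m y ->
  x = y.
Proof.
move=> Ix Iy; rewrite !ler_norml => /andP[? ?] /andP[? ?].
by case: (ltgtP x y) => // xy; [have := gap_lt gs Ix Iy xy|have := gap_lt gs Iy Ix xy];
  lra.
Qed.

(** The map which collapses each gap to the point it comes from. *)
Definition collapse u := get [set x | I x /\ `|u - C x| <= m x].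
Local Notation h := collapse.

Lemma collapseP u : I u -> I (h u) /\ `|u - C (h u)| <= m (h u).
Proof.
move=> /(gs_cover gs)[x Ix ux].
exact: (@getPex _ [set x | I x /\ `|u - C x| <= m x] (ex_intro _ x (conj Ix ux))).
Qed.

Lemma collapse_in u : I u -> I (h u). Proof. by case/collapseP. Qed.

Lemma collapse_eq u x : I x -> `|u - C x| <= m x -> h u = x.
Proof.
move=> Ix ux; have [Ih uh] := collapseP (gs_stable gs Ix ux).
exact: gap_uniq uh ux.
Qed.

Lemma collapse_le u v : I u -> I v -> u <= v -> h u <= h v.
Proof.
move=> Iu Iv uv; rewrite leNgt; apply/negP => hvu.
have [Ihu uh] := collapseP Iu; have [Ihv vh] := collapseP Iv.
have := gap_lt gs Ihv Ihu hvu; move: uh vh; rewrite !ler_norml.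
by move=> /andP[? ?] /andP[? ?]; lra.
Qed.

Lemma collapse_continuous u e : I u -> 0 < e ->
  exists2 d, 0 < d & forall v, I v -> `|v - u| < d -> `|h v - h u| < e.
Proof.
move=> Iu e0; have [Ihu uh] := collapseP Iu.
have [d1 d10 H1] : exists2 d, 0 < d & forall v, I v -> v < u + d -> h v < h u + e.
  have [[y Iy /andP[hy ye]]|noy] :=
      pselect (exists2 y, I y & h u < y < h u + e).
    exists (C y - m y - u).
      have := gap_lt gs Ihu Iy hy; move: uh; rewrite ler_norml => /andP[? ?]; lra.
    move=> v Iv; rewrite addrC subrK => vy; apply: le_lt_trans ye.
    rewrite leNgt; apply/negP => yv; have [Ihv vh] := collapseP Iv.
    by have := gap_lt gs Iy Ihv yv; move: vh (m0 y); rewrite ler_norml => /andP[? ?]; lra.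
  exists 1 => // v Iv _; rewrite ltNge; apply/negP => hv; apply: noy.
  exists (h u + e / 2); last lra.
  by apply: (gs_itv gs Ihu (collapse_in Iv)); lra.
have [d2 d20 H2] : exists2 d, 0 < d & forall v, I v -> u - d < v -> h u - e < h v.
  have [[y Iy /andP[ye hy]]|noy] :=
      pselect (exists2 y, I y & h u - e < y < h u).
    exists (u - (C y + m y)).
      have := gap_lt gs Iy Ihu hy; move: uh; rewrite ler_norml => /andP[? ?]; lra.
    move=> v Iv; rewrite opprB addrC subrK => vy; apply: (lt_le_trans ye).
    rewrite leNgt; apply/negP => yv; have [Ihv vh] := collapseP Iv.
    by have := gap_lt gs Ihv Iy yv; move: vh (m0 y); rewrite ler_norml => /andP[? ?]; lra.
  exists 1 => // v Iv _; rewrite ltNge; apply/negP => hv; apply: noy.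
  exists (h u - e / 2); last lra.
  by apply: (gs_itv gs (collapse_in Iv) Ihu); lra.
exists (Num.min d1 d2); first by rewrite lt_min d10.
move=> v Iv; rewrite lt_min !ltr_norml => /andP[/andP[? ?] /andP[? ?]].
by have := H1 v Iv; have := H2 v Iv => K1 K2; apply/andP; split;
  [have := K1 ltac:(lra)|have := K2 ltac:(lra)]; lra.
Qed.

Lemma monotone_bij_esum sg f (g : R -> \bar R) x y : monotone_bij I sg f ->
    I x -> I y -> x < y ->
  \esum_(t in `]Num.min (f x) (f y), Num.max (f x) (f y)[) g t =
  \esum_(t in `]x, y[) g (f t).
Proof.
move=> [sgE fI fS fM] Ix Iy xy; apply: reindex_esum; split.
- move=> t /=; rewrite !in_itv/= => /andP[xt ty].
  have It : I t by apply: (gs_itv gs Ix Iy); rewrite !ltW.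
  have := fM _ _ Ix It xt; have := fM _ _ It Iy ty.
  rewrite gt_min lt_max.
  case: sgE => ->; rewrite ?mul1r ?mulN1r ?oppr_gt0 ?subr_gt0 ?subr_lt0.
    by move=> -> ->; rewrite orbT.
  by move=> -> ->; rewrite orbT.
- move=> s t /set_mem/= + /set_mem/=; rewrite !in_itv/=.
  move=> /andP[xs sy] /andP[xt ty] fst.
  have It : I t by apply: (gs_itv gs Ix Iy); rewrite !ltW.
  have Is : I s by apply: (gs_itv gs Ix Iy); rewrite !ltW.
  by case: (ltgtP s t) => // st; [have := fM _ _ Is It st|have := fM _ _ It Is st];
    rewrite fst subrr mulr0 ltxx.
- move=> z /=; rewrite in_itv/= gt_min lt_max => zI.
  have Iz : I z.
    case/andP: zI => /orP[z1|z1] /orP[z2|z2].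
    + by move: (lt_trans z1 z2); rewrite ltxx.
    + by apply: (gs_itv gs (fI _ Ix) (fI _ Iy)); rewrite !ltW.
    + by apply: (gs_itv gs (fI _ Iy) (fI _ Ix)); rewrite !ltW.
    + by move: (lt_trans z1 z2); rewrite ltxx.
  have [t It ftz] := fS _ Iz; exists t => //; rewrite /= in_itv/=.
  have fxy := fM _ _ Ix Iy xy.
  apply/andP; split; rewrite ltNge; apply/negP; rewrite le_eqVlt.
    move=> /predU1P[tx|tx].
      by move: fxy zI; rewrite -ftz tx; case: sgE => -> ? /andP[/orP[] ? /orP[] ?]; lra.
    have := fM _ _ It Ix tx; rewrite ftz.
    by case: sgE fxy => -> ? ?; case/andP: zI => /orP[] ? /orP[] ?; lra.
  move=> /predU1P[tx|tx].
    by move: fxy zI; rewrite -ftz -tx; case: sgE => -> ? /andP[/orP[] ? /orP[] ?]; lra.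
  have := fM _ _ Iy It tx; rewrite ftz.
  by case: sgE fxy => -> ? ?; case/andP: zI => /orP[] ? /orP[] ?; lra.
Qed.

(** The distance between the gaps of [f x] and [f y]. *)
Lemma monotone_bij_dist sg f x y : monotone_bij I sg f -> I x -> I y -> x < y ->
  (sg * (C (f y) - C (f x)) - m (f x) - m (f y))%:E =
  \esum_(t in `]x, y[) (2 * m (f t))%:E.
Proof.
move=> mb Ix Iy xy.
rewrite -(monotone_bij_esum (fun t => (2 * m t)%:E) mb Ix Iy xy).
have [sgE fI _ fM] := mb.
have := fM _ _ Ix Iy xy; case: sgE => -> fxy.
  have fxy' : f x < f y by lra.
  rewrite min_l ?max_r ?ltW// -(gs_dist gs (fI _ Ix) (fI _ Iy) fxy').
  by congr EFin; ring.
have fxy' : f y < f x by lra.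
rewrite min_r ?max_l ?ltW// -(gs_dist gs (fI _ Iy) (fI _ Ix) fxy').
by congr EFin; ring.
Qed.


Section Hat.
Variables (sg : R) (f : R -> R).
Hypotheses (mb : monotone_bij I sg f) (ta : tame I m f).

Let fI := mb_fun mb.

Let sgsq : sg * sg = 1.
Proof. by case: (mb_sign mb) => ->; rewrite ?mulrNN mulr1. Qed.

Let sgnorm : `|sg| = 1.
Proof. by case: (mb_sign mb) => ->; rewrite ?normrN normr1. Qed.

(** The map which sends the gap of [x] onto the gap of [f x] by [gap_map], after a
reflection if [f] is decreasing. *)
Definition blown_map u :=
  C (f (h u)) + sg * gap_map (m (h u)) (m (f (h u))) (u - C (h u)).

(** The derivative of [blown_map], up to the sign [sg]. *)
Definition blown_deriv u :=
  gap_deriv (m (h u)) (m (f (h u))) (u - C (h u)).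

Lemma tame0 x : I x -> m x = 0 -> m (f x) = 0.
Proof.
move=> Ix mx0; have := tame_pos ta Ix; rewrite mx0 ltxx => /esym.
by rewrite lt0r m0 andbT => /negbFE/eqP.
Qed.

Lemma tame_gt0 x : I x -> 0 < m x -> 0 < m (f x).
Proof. by move=> Ix; rewrite (tame_pos ta Ix). Qed.

Lemma tame_gap_map_le x s : I x -> `|s| <= m x ->
  `|gap_map (m x) (m (f x)) s| <= m (f x).
Proof.
move=> Ix sx; have := m0 x; rewrite le_eqVlt => /predU1P[m0x|mx].
  by rewrite -m0x gap_map0 normr0.
by apply: gap_map_le => //; exact: tame_gt0.
Qed.

Lemma tame_gap_map_end x : I x -> gap_map (m x) (m (f x)) (m x) = m (f x).
Proof.
move=> Ix; have := m0 x; rewrite le_eqVlt => /predU1P[m0x|mx].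
  by rewrite -m0x gap_map0 tame0.
by rewrite gap_map_end// tame_gt0.
Qed.

Lemma collapse_blown_map u : I u -> h (blown_map u) = f (h u).
Proof.
move=> Iu; have [Ih uh] := collapseP Iu; apply: collapse_eq; first exact: fI.
by rewrite /blown_map addrC addKr normrM sgnorm mul1r tame_gap_map_le.
Qed.

Lemma blown_map_in u : I u -> I (blown_map u).
Proof.
move=> Iu; have [Ih uh] := collapseP Iu; apply: (gs_stable gs (fI Ih)).
by rewrite /blown_map addrC addKr normrM sgnorm mul1r tame_gap_map_le.
Qed.

Lemma blown_deriv_at x s : I x -> `|s| <= m x ->
  blown_deriv (C x + s) = gap_deriv (m x) (m (f x)) s.
Proof.
move=> Ix sx; rewrite /blown_deriv (_ : h (C x + s) = x); last first.
  by apply: collapse_eq => //; rewrite addrC addKr.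
by rewrite [in LHS]addrC addKr.
Qed.

(** The increment bound for two points of the same gap. *)
Lemma tame_gap_map_bound lo hi x s1 s2 : I x -> - m x <= s1 -> s1 <= s2 ->
    s2 <= m x ->
    (forall w, I w -> C x + s1 <= w <= C x + s2 -> lo <= blown_deriv w <= hi) ->
  lo * (s2 - s1) <= gap_map (m x) (m (f x)) s2 - gap_map (m x) (m (f x)) s1
    <= hi * (s2 - s1).
Proof.
move=> Ix s1x s12 s2x H; apply: gap_map_incr_bound => //.
  exact: tame_gt0.
move=> s /andP[s1s ss2]; have sx : `|s| <= m x.
  by rewrite ler_norml (le_trans s1x s1s) (le_trans ss2 s2x).
rewrite -(blown_deriv_at Ix sx); apply: H.
  by apply: (gs_stable gs Ix); rewrite addrC addKr.
by rewrite !lerD2l s1s.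
Qed.

(** If [u] and [v] lie in different gaps then [v - u] is the sum of a piece of the
gap of [u], of the gaps in between, and of a piece of the gap of [v], and the
bound holds for each of these by the mean value theorem. *)
Lemma blown_map_incr_bound lo hi u v : I u -> I v -> u <= v ->
    (forall w, I w -> u <= w <= v -> lo <= blown_deriv w <= hi) ->
  lo * (v - u) <= sg * (blown_map v - blown_map u) <= hi * (v - u).
Proof.
move=> Iu Iv uv H; have [Ix] := collapseP Iu; have [Iy] := collapseP Iv.
rewrite /blown_map; set x := h u in Ix *; set y := h v in Iy *.
rewrite !ler_norml => /andP[y1 y2] /andP[x1 x2].
have := collapse_le Iu Iv uv; rewrite -/x -/y le_eqVlt => /predU1P[xy|xy].
  rewrite -xy in y1 y2 *.
  set a := gap_map _ _ _; set b := gap_map _ _ _.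
  rewrite (_ : sg * _ = sg * sg * (a - b)); last by ring.
  rewrite sgsq mul1r (_ : v - u = v - C x - (u - C x)); last by ring.
  apply: tame_gap_map_bound => //; first lra.
  by move=> w Iw ?; apply: H => //; lra.
have gxy := gap_lt gs Ix Iy xy.
have Iux : I (C x + m x).
  by apply: (gs_stable gs Ix); rewrite addrC addKr ger0_norm.
(* The right end of the gap of [u] lies between [u] and [v]. *)
have /andP[lo1 hi1] : lo <= 1 <= hi.
  rewrite (_ : 1 = blown_deriv (C x + m x)); first by apply: H => //; lra.
  rewrite blown_deriv_at ?ger0_norm// gap_deriv_out ?ger0_norm//.
  exact: tame_gt0.
have /andP[L1 L2] : lo * (m x - (u - C x)) <= m (f x) -
    gap_map (m x) (m (f x)) (u - C x) <= hi * (m x - (u - C x)).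
  have := @tame_gap_map_bound lo hi x (u - C x) (m x) Ix x1 x2 (lexx _).
  by rewrite (tame_gap_map_end Ix); apply => w Iw ?; apply: H => //; lra.
have mendN : - m (f y) = gap_map (m y) (m (f y)) (- m y).
  by rewrite gap_mapN tame_gap_map_end.
have /andP[L3 L4] : lo * (v - C y - - m y) <=
    gap_map (m y) (m (f y)) (v - C y) - - m (f y) <= hi * (v - C y - - m y).
  rewrite mendN.
  by apply: tame_gap_map_bound => // w Iw ?; apply: H => //; lra.
have middle t : t \in `]x, y[ -> lo * (2 * m t) <= 2 * m (f t) <= hi * (2 * m t).
  rewrite in_itv/= => /andP[xt ty].
  have It : I t by apply: (gs_itv gs Ix Iy); rewrite !ltW.
  have := gap_lt gs Ix It xt; have := gap_lt gs It Iy ty => ? ?.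
  have mt := m0 t.
  have -> : 2 * m (f t) = gap_map (m t) (m (f t)) (m t) -
      gap_map (m t) (m (f t)) (- m t).
    by rewrite gap_mapN tame_gap_map_end//; ring.
  have -> : 2 * m t = m t - (- m t) by ring.
  by apply: tame_gap_map_bound => //; [lra|move=> w Iw ?; apply: H => //; lra].
have eA := gs_dist gs Ix Iy xy.
have eB := monotone_bij_dist mb Ix Iy xy.
set A := C y - _ - _ - _ in eA; set B := _ - _ - _ in eB.
have ge02 t : 0 <= 2 * m t by rewrite mulr_ge0.
have ge02f t : 0 <= 2 * m (f t) by rewrite mulr_ge0.
have BA : B <= hi * A.
  apply: (esum_le_scale ge02 _ _ eA eB); last lra.
  by move=> t /= /middle/andP[].
(* For [lo > 0] this is the upper bound with the two sums exchanged. *)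
have AB : lo * A <= B.
  have A0 : 0 <= A by rewrite -lee_fin eA; apply: esum_ge0 => t _; rewrite lee_fin.
  have B0 : 0 <= B by rewrite -lee_fin eB; apply: esum_ge0 => t _; rewrite lee_fin.
  have [lo0|lo0] := leP lo 0.
    by apply: le_trans B0; rewrite -oppr_ge0 -mulNr mulr_ge0// oppr_ge0.
  rewrite -ler_pdivlMl//; apply: (esum_le_scale ge02f _ _ eB eA).
    by move=> t /= /middle/andP[+ _]; rewrite ler_pdivlMl.
  by rewrite invr_ge0 ltW.
set a := gap_map _ _ _ in L3 L4 *; set b := gap_map _ _ _ in L1 L2 *.
rewrite (_ : sg * (C (f y) + sg * a - (C (f x) + sg * b)) =
  (m (f x) - b) + B + (a - - m (f y)) + (sg * sg - 1) * (a - b)); last first.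
  by rewrite /B; ring.
rewrite sgsq subrr mul0r addr0.
rewrite (_ : v - u = (m x - (u - C x)) + A + (v - C y - - m y)); last first.
  by rewrite /A; ring.
rewrite (mulrDr lo (_ + A)) (mulrDr lo _ A) (mulrDr hi (_ + A)) (mulrDr hi _ A).
by apply/andP; split; rewrite !lerD.
Qed.

Lemma blown_deriv_gt0 u : I u -> 0 < blown_deriv u.
Proof.
by move=> Iu; apply: gap_deriv_gt0 => //; apply: tame_gt0; exact: collapse_in.
Qed.

(** Continuity of the derivative associated with one fixed gap, as a function on
the whole line. *)
Lemma gap_nbhs p u e : I p -> 0 < e -> exists2 d, 0 < d &
  forall v, `|v - u| < d ->
    `|gap_deriv (m p) (m (f p)) (v - C p) - gap_deriv (m p) (m (f p)) (u - C p)|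
      < e.
Proof.
move=> Ip e0.
have cg := @gap_deriv_continuous R (m p) (m (f p)) (m0 p) (tame_gt0 Ip) (u - C p).
have /cvgrPdist_lt/(_ e e0) := cg; move=> /nbhs_ballP[d /= d0 H]; exists d => //.
move=> v vu; rewrite distrC; apply: H; rewrite /ball/= distrC.
by rewrite (_ : _ - _ = v - u)//; ring.
Qed.

(** Near [u] the derivative at [v] is given by the gap of [v]. This gap is either
that of [u], or one of the finitely many exceptional ones, for each of which the
associated derivative is continuous and equal to [1] at [u], or one on which the
derivative is uniformly close to [1]. *)
Lemma blown_deriv_continuous u e : I u -> 0 < e -> exists2 d, 0 < d &
  forall v, I v -> `|v - u| < d -> `|blown_deriv v - blown_deriv u| < e.
Proof.
move=> Iu e0; have [Ix ux] := collapseP Iu; set x := h u in Ix ux.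
(* [gap_deriv_bound] turns a ratio [1 + e1] into [7 * e1 < e / 2]. *)
pose e1 := Num.min 1 (e / 15).
have e10 : 0 < e1 by rewrite lt_min ltr01 divr_gt0.
have e11 : e1 <= 1 by rewrite ge_min lexx.
have e1e : e1 <= e / 15 by rewrite ge_min lexx orbT.
have [d1 d10 finB] := tame_ratio ta Ix e10.
set B := [set p | _] in finB.
have [d2 d20 H2] := collapse_continuous Iu d10.
have [d3 d30 H3] := gap_nbhs u Ix (divr_gt0 e0 (ltr0Sn R 1)).
pose Q p s := forall v, `|v - u| <= s ->
    `|gap_deriv (m p) (m (f p)) (v - C p) - gap_deriv (m p) (m (f p)) (u - C p)|
      < e / 2.
have [|d4 d40 H4] := finite_common_radius (Q := Q) finB.
  move=> p [Ip _ _ _]; have [d d0 H] := gap_nbhs u Ip (divr_gt0 e0 (ltr0Sn R 1)).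
  by exists d => // s sd v vs; apply: H; exact: le_lt_trans sd.
exists (Num.min d2 (Num.min d3 d4)); first by rewrite !lt_min d20 d30.
move=> v Iv; rewrite !lt_min => /and3P[vd2 vd3 vd4].
have [Iy vy] := collapseP Iv.
have := H2 v Iv vd2; rewrite /blown_deriv -/x; set y := h v in Iy vy * => yx.
have [yxE|yxN] := eqVneq y x.
  by rewrite yxE; apply: lt_le_trans (H3 v vd3) _; lra.
(* Points of the gap of [z] lie outside the interior of any other gap. *)
have out z w t : I z -> I w -> z != w -> `|t - C z| <= m z ->
    gap_deriv (m w) (m (f w)) (t - C w) = 1.
  move=> Iz Iw zw tz; apply: gap_deriv_out => //; first exact: tame_gt0.
  rewrite leNgt; apply/negP => /ltW tw; case/eqP: zw; exact: gap_uniq tz tw.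
have k1 := out _ _ _ Iy Ix yxN vy.
have := H3 v vd3; rewrite k1 => k2.
have [By|nBy] := pselect (B y).
  have := H4 _ _ By vd4 v (lexx _); rewrite (out _ _ _ Ix Iy _ ux) 1?eq_sym//.
  move: k2; rewrite !ltr_norml => /andP[? ?] /andP[? ?]; lra.
have [my|my] := leP (m y) 0.
  have -> : m y = 0 by apply/le_anti; rewrite my m0.
  rewrite /gap_deriv eqxx -/(gap_deriv _ _ _).
  by apply: (lt_le_trans k2); lra.
have [r1 r2] : m y <= (1 + e1) * m (f y) /\ m (f y) <= (1 + e1) * m y.
  by apply: contrapT => nr; apply: nBy.
have k3 : `|gap_deriv (m y) (m (f y)) (v - C y) - 1| <= 7 * e1.
  by apply: gap_deriv_bound; rewrite ?e10// tame_gt0.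
move: k2 k3; rewrite !ltr_norml !ler_norml => /andP[? ?] /andP[? ?]; lra.
Qed.

(** Since [|sg| = 1], this says that [sg * blown_deriv u] is the derivative of the
map at [u], relatively to [I]. *)
Lemma blown_map_derivative u e : I u -> 0 < e -> exists2 d, 0 < d &
  forall v, I v -> `|v - u| < d ->
    `|blown_map v - blown_map u - sg * blown_deriv u * (v - u)| <= e * `|v - u|.
Proof.
move=> Iu e0; have [d d0 H] := blown_deriv_continuous Iu e0.
exists d => // v Iv vu.
set D := blown_deriv u in H *.
rewrite -[leLHS]mul1r -sgnorm -normrM.
rewrite (_ : sg * (blown_map v - blown_map u - sg * D * (v - u)) =
  sg * (blown_map v - blown_map u) - sg * sg * D * (v - u)); last by ring.
rewrite sgsq mul1r.
have [uv|uv] := leP u v.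
  have /andP[] : (D - e) * (v - u) <= sg * (blown_map v - blown_map u)
      <= (D + e) * (v - u).
    apply: blown_map_incr_bound => // w Iw /andP[uw wv]; have : `|w - u| < d.
      by apply: le_lt_trans vu; rewrite !ger0_norm ?subr_ge0// lerB.
    by move=> /(H w Iw); rewrite ltr_norml; lra.
  by rewrite (ger0_norm (_ : 0 <= v - u)) ?subr_ge0// ler_norml; lra.
have /andP[] : (D - e) * (u - v) <= sg * (blown_map u - blown_map v)
    <= (D + e) * (u - v).
  apply: (blown_map_incr_bound Iv Iu (ltW uv)) => w Iw /andP[uw wv]; have : `|w - u| < d.
    apply: le_lt_trans vu.
    by rewrite !ler0_norm ?subr_le0 ?(ltW uv)// lerN2 lerB.
  by move=> /(H w Iw); rewrite ltr_norml; lra.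
by rewrite (ler0_norm (_ : v - u <= 0)) ?subr_le0 ?(ltW uv)// ler_norml; lra.
Qed.

Lemma blown_map_continuous u e : I u -> 0 < e -> exists2 d, 0 < d &
  forall v, I v -> `|v - u| < d -> `|blown_map v - blown_map u| < e.
Proof.
move=> Iu e0; have [d d0 H] := blown_map_derivative Iu ltr01.
have D0 := blown_deriv_gt0 Iu; set D := blown_deriv u in D0 H.
exists (Num.min d (e / (D + 2))); first by rewrite lt_min d0 divr_gt0//; lra.
move=> v Iv; rewrite lt_min => /andP[vd ve].
have := H v Iv vd; rewrite mul1r => k.
have : `|sg * D * (v - u)| = D * `|v - u|.
  by rewrite !normrM sgnorm mul1r gtr0_norm.
have := ler_normD (blown_map v - blown_map u - sg * D * (v - u)) (sg * D * (v - u)).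
rewrite subrK; move: ve; rewrite ltr_pdivlMr; last lra.
by have := normr_ge0 (v - u); nra.
Qed.

End Hat.

Lemma blown_map_comp sg sg' f g u : monotone_bij I sg f -> tame I m f ->
    monotone_bij I sg' g -> tame I m g -> I u ->
  blown_map sg' g (blown_map sg f u) = blown_map (sg' * sg) (g \o f) u.
Proof.
move=> mbf taf mbg tag Iu; rewrite {1}/blown_map collapse_blown_map//.
have [Ix ux] := collapseP Iu; set x := h u in Ix ux *.
rewrite [blown_map sg f u]/blown_map -/x [RHS]/blown_map -/x /=.
rewrite (addrC (C (f x))) addrK -mulrA; congr (_ + _ * _).
have sgg a b s : gap_map a b (sg * s) = sg * gap_map a b s.
  by case: (mb_sign mbf) => ->; rewrite ?mul1r// !mulN1r gap_mapN.
rewrite sgg; congr (_ * _); have := m0 x; rewrite le_eqVlt => /predU1P[mx|mx].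
  by rewrite -mx (tame0 taf Ix (esym mx)) !gap_map0.
by rewrite gap_map_comp ?(tame_gt0 taf Ix mx)// ?(tame_gt0 tag (mb_fun mbf Ix))//
  (tame_gt0 taf Ix mx).
Qed.

End Line.

(** * Positions of the gaps *)

(** A summable family is small off some finite set. *)
Lemma esum_tail (R : realType) (T : choiceType) (D : set T) (g : T -> R)
    (A e : R) : (forall t, 0 <= g t) -> \esum_(t in D) (g t)%:E = A%:E -> 0 < e ->
  exists2 X, finite_set X /\ X `<=` D & forall D', D' `<=` D -> D' `&` X = set0 ->
    (\esum_(t in D') (g t)%:E <= e%:E)%E.
Proof.
move=> g0 eA e0.
have : ((A - e)%:E < \esum_(t in D) (g t)%:E)%E by rewrite eA lte_fin; lra.
move=> /ereal_sup_gt[_ [X [finX XD] <-] AX]; exists X => // D' D'D DX.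
apply: ge_ereal_sup => _ [Y [finY YD'] <-].
have XY0 : Y `&` X = set0.
  by rewrite -subset0 -DX => t [Yt Xt]; split => //; exact: YD'.
have : (\sum_(t \in Y `|` X) (g t)%:E <= A%:E)%E.
  rewrite -eA; apply: ereal_sup_ubound; exists (Y `|` X) => //; split.
    by rewrite finite_setU.
  by move=> t [/YD'/D'D|/XD].
rewrite fsbigU0//; last by rewrite XY0.
rewrite !fsumEFin// /= -EFinD lte_fin !lee_fin in AX *; lra.
Qed.

(** There are no jumps other than the gaps: if [u] lies between the left end of the
gap of [x0] and the right end of the gap of [x1] then it belongs to the gap of
the supremum of the points whose gap starts before [u], because the total length
of the gaps close to a point, on one side of it, is small. *)
Lemma gap_cover (R : realType) (I : set R) (m C : R -> R) u x0 x1 :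
    gap_spacing I m C -> I x0 -> I x1 -> C x0 - m x0 <= u -> u <= C x1 + m x1 ->
  exists2 x, I x & `|u - C x| <= m x.
Proof.
move=> gs I0 I1 ux0 ux1.
have m0 := gs_ge0 gs.
have ge02 t : 0 <= 2 * m t by rewrite mulr_ge0.
pose S := [set x | I x /\ C x - m x <= u].
have Sub x : S x -> x <= x1.
  move=> [Ix xu]; rewrite leNgt; apply/negP => lt_x1x.
  by have := gap_lt gs I1 Ix lt_x1x; lra.
have supS : has_sup S by split; [exists x0|exists x1 => x /Sub].
pose s := sup S.
have s0 : x0 <= s by apply: ub_le_sup => //; case: supS.
have s1 : s <= x1 by apply: ge_sup; [exists x0|move=> x /Sub].
have Is : I s by apply: (gs_itv gs I0 I1); rewrite s0 s1.
exists s => //; rewrite ler_norml; apply/andP; split; last first.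
  rewrite leNgt; apply/negP => us.
  have lt_s_x1 : s < x1.
    by rewrite lt_neqAle s1 andbT; apply/eqP => sx1; move: us; rewrite sx1; lra.
  have e0 : 0 < u - C s - m s by lra.
  have [X [finX XD] HX] := esum_tail ge02 (esym (gs_dist gs Is I1 lt_s_x1)) e0.
  have [|d d0 Hd] := @finite_common_radius _ X (fun p t => t < p - s) finX.
    move=> p /XD/=; rewrite in_itv/= => /andP[sp _]; exists (p - s) => //; lra.
  pose y := Num.min x1 (s + d / 2).
  have sy : s < y by rewrite lt_min lt_s_x1; lra.
  have yx1 : y <= x1 by rewrite ge_min lexx.
  have Iy : I y by apply: (gs_itv gs Is I1); rewrite yx1 ltW.
  have yd : y <= s + d / 2 by rewrite ge_min lexx orbT.
  pose z := (s + y) / 2.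
  have Iz : I z by apply: (gs_itv gs Is Iy); rewrite /z; lra.
  have sz : s < z by rewrite /z; lra.
  have zy : z < y by rewrite /z; lra.
  suff Sz : S z by have := ub_le_sup (let: conj _ h := supS in h) Sz; rewrite -/s; lra.
  split=> //; have := gap_lt gs Iz Iy zy.
  have : (\esum_(t in `]s, y[) (2 * m t)%:E <= (u - C s - m s)%:E)%E.
    apply: HX.
      by move=> t /=; rewrite !in_itv/= => /andP[->]/= /lt_le_trans; apply.
    rewrite -subset0 => t [/=]; rewrite in_itv/= => /andP[_ ty].
    have dd : d / 2 < d by lra.
    by move=> Xt; have := Hd _ _ Xt dd; lra.
  rewrite -(gs_dist gs Is Iy sy) lee_fin; have := m0 z; lra.
rewrite leNgt; apply/negP => us.
have lt_x0_s : x0 < s.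
  by rewrite lt_neqAle s0 andbT; apply/eqP => sx0; move: us; rewrite -sx0; lra.
have e0 : 0 < C s - m s - u by lra.
have [X [finX XD] HX] := esum_tail ge02 (esym (gs_dist gs I0 Is lt_x0_s)) e0.
have [|d d0 Hd] := @finite_common_radius _ X (fun p t => t < s - p) finX.
  by move=> p /XD/=; rewrite in_itv/= => /andP[_ sp]; exists (s - p) => //; lra.
pose y := Num.max x0 (s - d / 2).
have ys : y < s by rewrite gt_max lt_x0_s; lra.
have x0y : x0 <= y by rewrite le_max lexx.
have Iy : I y by apply: (gs_itv gs I0 Is); rewrite x0y ltW.
have yd : s - d / 2 <= y by rewrite le_max lexx orbT.
have small : (\esum_(t in `]y, s[) (2 * m t)%:E <= (C s - m s - u)%:E)%E.
  apply: HX.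
    by move=> t /=; rewrite !in_itv/= => /andP[yt ->]; rewrite (le_lt_trans x0y yt).
  rewrite -subset0 => t [/=]; rewrite in_itv/= => /andP[yt _].
  have dd : d / 2 < d by lra.
    by move=> Xt; have := Hd _ _ Xt dd; lra.
have sy0 : 0 < s - y by rewrite subr_gt0.
have [z [Iz zu] yz] := sup_adherent sy0 supS.
rewrite -/s opprB addrC subrK in yz.
have := gap_lt gs Iy Iz yz.
move: small; rewrite -(gs_dist gs Iy Is ys) lee_fin; lra.
Qed.

Section GapCenter.
Variables (R : realType) (m : R -> R) (x0 : R).
Hypothesis m0 : forall t, 0 <= m t.
Hypothesis mfin : forall x y, (\esum_(t in `[x, y[) (2 * m t)%:E < +oo)%E.

(** The total length of the gaps of the points of [[x, y[]. *)
Definition gap_mass x y : R := fine (\esum_(t in `[x, y[) (2 * m t)%:E).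

Let ge02 t : (0 <= (2 * m t)%:E)%E. Proof. by rewrite lee_fin mulr_ge0. Qed.

Lemma gap_massE x y : (gap_mass x y)%:E = \esum_(t in `[x, y[) (2 * m t)%:E.
Proof.
rewrite /gap_mass fineK// ge0_fin_numE ?mfin//.
by apply: esum_ge0 => t _; exact: ge02.
Qed.

Lemma gap_mass_ge0 x y : 0 <= gap_mass x y.
Proof. by rewrite -lee_fin gap_massE; apply: esum_ge0. Qed.

Lemma gap_massxx x : gap_mass x x = 0.
Proof. by rewrite /gap_mass set_itvco0 esum_set0. Qed.

Lemma gap_massD x y z : x <= y -> y <= z ->
  gap_mass x z = gap_mass x y + gap_mass y z.
Proof.
move=> xy yz; apply/EFin_inj; rewrite EFinD !gap_massE (esumID `[x, y[)//.
congr (_ + _)%E; congr esum; apply/seteqP; split => t /=; rewrite !in_itv/=.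
- by case.
- by move=> /andP[-> ty]; rewrite ty (lt_le_trans ty yz).
- by move=> [/andP[-> ->]] /negP; rewrite -leNgt => ->.
- move=> /andP[yt ->]; rewrite (le_trans xy yt); split => //.
  by apply/negP; rewrite -leNgt.
Qed.

Lemma gap_mass_open x y : x < y ->
  (gap_mass x y - 2 * m x)%:E = \esum_(t in `]x, y[) (2 * m t)%:E.
Proof.
move=> xy; rewrite EFinB gap_massE (esumID [set x])//.
have -> : `[x, y[%classic `&` [set x] = [set x].
  apply/seteqP; split => t /=; rewrite in_itv/=; first by case.
  by move=> ->; rewrite lexx xy.
have -> : `[x, y[%classic `&` ~` [set x] = `]x, y[%classic; last first.
  by rewrite esum_set1// addeAC subee// add0e.
apply/seteqP; split => t /=; rewrite !in_itv/=.
  by move=> [/andP[xt ->] /eqP]; rewrite lt_neqAle eq_sym xt => ->.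
move=> /andP[xt ->]; rewrite ltW//; split => // tx; move: xt.
by rewrite tx ltxx.
Qed.

(** The left end of the gap of [x], relatively to the left end of that of [x0]. *)
Definition gap_left x := if x0 <= x then gap_mass x0 x else - gap_mass x x0.

(** The centre of the gap of [x] when the left end of the gap of [x0] is placed at
[x0]. *)
Definition gap_center x := x0 + gap_left x + m x.

Lemma gap_leftB x y : x <= y -> gap_left y - gap_left x = gap_mass x y.
Proof.
move=> xy; rewrite /gap_left; have [x0x|xx0] := leP x0 x.
  by rewrite (le_trans x0x xy) (gap_massD x0x xy); ring.
have [x0y|yx0] := leP x0 y.
  by rewrite (gap_massD (ltW xx0) x0y); ring.
by rewrite (gap_massD xy (ltW yx0)); ring.
Qed.

Lemma gap_left0 : gap_left x0 = 0.
Proof. by rewrite /gap_left lexx gap_massxx. Qed.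

Lemma gap_center_dist x y : x < y ->
  (gap_center y - gap_center x - m x - m y)%:E =
  \esum_(t in `]x, y[) (2 * m t)%:E.
Proof.
move=> xy; rewrite -gap_mass_open// -(gap_leftB (ltW xy)); congr EFin.
by rewrite /gap_center; ring.
Qed.

Lemma gap_center_spacing (I : set R) : is_interval I ->
    (forall x y, I x -> I y -> x < y -> exists2 p, x < p < y & 0 < m p) ->
  gap_spacing I m gap_center.
Proof. by move=> ? ?; split => // x y _ _; exact: gap_center_dist. Qed.

End GapCenter.

(** * Blowing up an action on a quotient of the line *)

Section Monotone.
Variables (M N : topologicalType) (h : M -> N).
Hypothesis (hclosed : forall A, closed A -> closed (h @` A)).
Hypothesis hsurj : forall q, exists p, h p = q.
Hypothesis hfib : forall q, connected (h @^-1` [set q]).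

(** Under a closed surjection with connected fibres, the preimage of a connected
set is connected: a relatively clopen part of the preimage is a union of
fibres, hence the preimage of a relatively clopen part. *)
Lemma closed_monotone_connected (J : set N) : connected J -> connected (h @^-1` J).
Proof.
move=> cJ B [b Bb] [V oV BV] [K cK BK].
have sat p q : h p = h q -> B p -> J (h q) -> B q.
  move=> pq Bp Jq.
  have := hfib (q := h q) (B := B `&` h @^-1` [set h q]); move=> H.
  have : (B `&` h @^-1` [set h q]) q; last by case.
  rewrite H //.
  - by exists p.
  - exists V => //; apply/seteqP; split => t [].
      by rewrite BV => -[_ Vt] tq; split.
    by move=> tq Vt; split => //; rewrite BV; split => //=; rewrite tq.
  - exists K => //; apply/seteqP; split => t [].
      by rewrite BK => -[_ Vt] tq; split.
    by move=> tq Vt; split => //; rewrite BK; split => //=; rewrite tq.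
have hB : h @` B = J.
  apply: cJ; first by exists (h b); exists b.
  - exists (~` (h @` (~` V))); first by rewrite openC; apply: hclosed; rewrite closedC.
    apply/seteqP; split => [_ [p Bp <-]|y [Jy nV]].
      have := Bp; rewrite BV => -[Jp Vp]; split => // -[q nVq qp]; apply: nVq.
      by have := sat p q (esym qp) Bp; rewrite /= qp => /(_ Jp); rewrite BV => -[].
    have [p py] := hsurj y; exists p => //; rewrite BV; split; first by rewrite /= py.
    by apply: contrapT => nVp; apply: nV; exists p.
  - exists (h @` K); first exact: hclosed.
    apply/seteqP; split => [_ [p Bp <-]|y [Jy [p Kp py]]].
      by have := Bp; rewrite BK => -[Jp Kp]; split => //; exists p.
    by exists p => //; rewrite BK; split => //=; rewrite py.
apply/seteqP; split => [p|p Jp]; first by rewrite BV => -[].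
have : (h @` B) (h p) by rewrite hB.
by case=> q Bq qp; apply: (sat q).
Qed.

End Monotone.

Section CompactQuotient.
Variables (R : realType) (M N : topologicalType) (pi : R -> M) (K : set R).
Hypotheses (picont : continuous pi) (cK : compact K).
Hypothesis piK : forall p, exists2 u, K u & pi u = p.

Lemma compact_quotient_continuous (F : M -> N) : hausdorff_space M ->
  continuous (F \o pi) -> continuous F.
Proof.
move=> hM cF; apply/continuous_closedP => A cA.
have -> : F @^-1` A = pi @` (K `&` (F \o pi) @^-1` A).
  apply/seteqP; split => [p Ap|_ [u [_ Au] <-]//].
  by have [u Ku up] := piK p; exists u => //; split => //=; rewrite up.
apply: compact_closed => //; apply: continuous_compact.
  exact: continuous_subspaceT.
by apply: compact_closedI => //; move: A cA; exact/continuous_closedP.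
Qed.

Lemma compact_quotient_compact : compact [set: M].
Proof.
have -> : [set: M] = pi @` K.
  by apply/seteqP; split => // p _; have [u Ku up] := piK p; exists u.
by apply: continuous_compact => //; exact: continuous_subspaceT.
Qed.

Lemma compact_quotient_closed (h : M -> N) : hausdorff_space N -> continuous h ->
  forall A, closed A -> closed (h @` A).
Proof.
move=> hN ch A cA; apply: compact_closed => //; apply: continuous_compact.
  exact: continuous_subspaceT.
by rewrite -(setTI A); apply: compact_closedI => //; exact: compact_quotient_compact.
Qed.

End CompactQuotient.

Lemma act_one (M : topologicalType) (G : groupType) (rho : action M G) :
  rho 1%g = id.
Proof.
have [k [gK kK _ _]] := act_homeo rho 1%g.
apply/funext => p; apply: (can_inj gK).
by have := congr1 (@^~ p) (actM rho 1%g 1%g); rewrite mulg1.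
Qed.

Lemma act_invK (M : topologicalType) (G : groupType) (rho : action M G) g :
  cancel (rho g) (rho g^-1%g).
Proof.
move=> p; have := congr1 (@^~ p) (actM rho g^-1%g g).
by rewrite mulVg act_one.
Qed.

(** [pi] presents [M] as the quotient of the interval [I] by the translations of
multiples of [tau]; for [tau = 0] it is injective on [I]. Since [pi] is defined
on the whole line, a retraction [r] of the line onto [I] which does not increase
distances, and such that [pi] factors through it, is part of the data. *)
Record chart (R : realType) (M : topologicalType) (I : set R) (tau : R)
    (pi : R -> M) (r : R -> R) : Prop := Chart {
  ch_itv : is_interval I;
  ch_two : exists x y, [/\ I x, I y & x < y];
  ch_tau : 0 <= tau;
  ch_cont : continuous pi;
  ch_r : forall u, I (r u);
  ch_lip : forall u v, `|r u - r v| <= `|u - v|;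
  ch_pir : forall u, pi (r u) = pi u;
  ch_inj : forall x y, I x -> I y -> pi x = pi y ->
    exists k : int, y = x + k%:~R * tau;
  ch_shift : forall x (k : int), I x -> I (x + k%:~R * tau);
  ch_per : forall x (k : int), I x -> pi (x + k%:~R * tau) = pi x;
  ch_compact : exists2 K, compact K & forall p, exists2 u, K u & pi u = p;
  ch_haus : hausdorff_space M }.

Definition continuous_on (R : realType) (I : set R) (F : R -> R) : Prop :=
  forall u e, I u -> 0 < e -> exists2 d, 0 < d &
    forall v, I v -> `|v - u| < d -> `|F v - F u| < e.

(** [D] is a continuous derivative of [F] relatively to [I]. *)
Definition C1_on (R : realType) (I : set R) (F D : R -> R) : Prop :=
  continuous_on I D /\ forall u e, I u -> 0 < e -> exists2 d, 0 < d &
    forall v, I v -> `|v - u| < d -> `|F v - F u - D u * (v - u)| <= e * `|v - u|.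

(** [f] is a lift of [F] to [I]. *)
Definition lifts (R : realType) (M : topologicalType) (I : set R) (pi : R -> M)
    (F : M -> M) (f : R -> R) : Prop :=
  (forall x, I x -> I (f x)) /\ forall x, I x -> pi (f x) = F (pi x).

Section Assembly.
Variables (R : realType) (M : topologicalType) (I : set R) (tau : R).
Variables (pi : R -> M) (r : R -> R).
Hypothesis ch : chart I tau pi r.

Lemma ch_section : exists s : M -> R, forall p, I (s p) /\ pi (s p) = p.
Proof.
have [K _ piK] := ch_compact ch.
have /choice[s Hs] : forall p, exists u, I u /\ pi u = p.
  move=> p; have [u _ <-] := piK p.
  by exists (r u); split; [exact: (ch_r ch)|exact: (ch_pir ch)].
by exists s.
Qed.

Lemma continuous_on_descend (F : R -> R) : (forall u, I u -> I (F u)) ->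
  continuous_on I F -> continuous (pi \o F \o r).
Proof.
move=> FI Fc u; apply: (@continuous_comp _ _ _ (F \o r)); last exact: (ch_cont ch).
apply/cvgrPdist_lt => e e0; have [d d0 H] := Fc (r u) e (ch_r ch u) e0.
apply/nbhs_ballP; exists d => //= v; rewrite /ball/= => uv.
rewrite distrC; apply: H; first exact: (ch_r ch).
by apply: le_lt_trans uv; rewrite distrC; exact: (ch_lip ch).
Qed.

Lemma descend_continuous (N : topologicalType) (F : M -> N) :
  continuous (F \o pi) -> continuous F.
Proof.
move=> cF; have [K cK piK] := ch_compact ch.
exact: (compact_quotient_continuous (ch_cont ch) cK piK (ch_haus ch)).
Qed.

(** The orientation of a lift is determined by the map. Two lifts differ by an
integral multiple of [tau]; if one is increasing and the other decreasing, this
multiple would change by a nonzero amount less than [tau] on a short segment. *)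
Lemma lift_sign (F : M -> M) sg sg' f f' : monotone_bij I sg f ->
  monotone_bij I sg' f' -> lifts I pi F f -> lifts I pi F f' -> sg = sg'.
Proof.
wlog : sg sg' f f' / sg = 1 /\ sg' = -1.
  move=> W mf mf' lf lf'.
  case: (mb_sign mf) => e1; case: (mb_sign mf') => e2; rewrite e1 e2//.
    by have := W _ _ _ _ (conj e1 e2) mf mf' lf lf'; rewrite e1 e2.
  by have := W _ _ _ _ (conj e2 e1) mf' mf lf' lf; rewrite e1 e2 => <-.
move=> [-> ->] mf mf' [fI lf] [f'I lf'].
have diff x : I x -> exists k : int, f x = f' x + k%:~R * tau.
  by move=> Ix; apply: (ch_inj ch (f'I _ Ix) (fI _ Ix)); rewrite lf// lf'.
have mono x y : I x -> I y -> x < y -> f x < f y.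
  by move=> Ix Iy xy; have := mb_mono mf Ix Iy xy; lra.
have mono' x y : I x -> I y -> x < y -> f' y < f' x.
  by move=> Ix Iy xy; have := mb_mono mf' Ix Iy xy; lra.
have [x [y [Ix Iy xy]]] := ch_two ch.
have := ch_tau ch; rewrite le_eqVlt => /predU1P[t0|t0].
  have [k kx] := diff _ Ix; have [l ly] := diff _ Iy.
  have := mono _ _ Ix Iy xy; have := mono' _ _ Ix Iy xy.
  by rewrite kx ly -t0; lra.
have Ithird z (k : int) : I z -> `|k%:~R : R| = 1 -> I (z + k%:~R * (tau / 3)).
  move=> Iz; have := ch_shift ch k Iz => Iz1.
  case: (ltrgtP (k%:~R : R) 0) => k0; last 1 first.
    by rewrite k0 normr0 => /eqP; rewrite eq_sym oner_eq0.
    rewrite ltr0_norm// => k1; have {}k1 : k%:~R = -1 :> R by lra.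
    by apply: (ch_itv ch Iz1 Iz); rewrite k1; lra.
  rewrite gtr0_norm// => k1.
  by apply: (ch_itv ch Iz Iz1); rewrite k1; lra.
(* [f] increases and [f'] decreases by at most [tau / 3] from [x] to [z], so
   their difference increases by an amount between [0] and [tau]. *)
have [y1 Iy1 fy1] : exists2 y, I y & f y = f x + tau / 3.
  apply: (mb_surj mf); have := Ithird _ 1 (fI _ Ix).
  by rewrite mul1r normr1; apply.
have [y2 Iy2 fy2] : exists2 y, I y & f' y = f' x - tau / 3.
  apply: (mb_surj mf'); have := Ithird _ (- 1) (f'I _ Ix).
  by rewrite mulrN1z mulN1r normrN normr1; apply.
have xy1 : x < y1.
  rewrite ltNge le_eqVlt; apply/negP => /predU1P[y1x|y1x].
    by move: fy1; rewrite y1x; lra.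
  by have := mono _ _ Iy1 Ix y1x; lra.
have xy2 : x < y2.
  rewrite ltNge le_eqVlt; apply/negP => /predU1P[y2x|y2x].
    by move: fy2; rewrite y2x; lra.
  by have := mono' _ _ Iy2 Ix y2x; lra.
pose z := Num.min y1 y2.
have xz : x < z by rewrite lt_min xy1.
have Iz : I z by rewrite /z; case: (leP y1 y2).
have fz : f z <= f x + tau / 3.
  rewrite -fy1; have : z <= y1 by rewrite ge_min lexx.
  by rewrite le_eqVlt => /predU1P[->//|] /(mono _ _ Iz Iy1)/ltW.
have f'z : f' x - tau / 3 <= f' z.
  rewrite -fy2; have : z <= y2 by rewrite ge_min lexx orbT.
  by rewrite le_eqVlt => /predU1P[->//|] /(mono' _ _ Iz Iy2)/ltW.
have [k kx] := diff _ Ix; have [l lz] := diff _ Iz.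
have := mono _ _ Ix Iz xz; have := mono' _ _ Ix Iz xz => h1 h2.
have b1 : 0 < (l - k)%:~R * tau by rewrite intrB mulrBl; lra.
have b2 : (l - k)%:~R * tau < 1 * tau by rewrite intrB mulrBl; lra.
rewrite pmulr_lgt0// ltr0z in b1; rewrite ltr_pM2r// (ltr_int _ _ 1) in b2.
by move: b1 b2; case: (l - k) => // -[|n].
Qed.

Variables (m C : R -> R) (w : M -> R).
Hypothesis gs : gap_system I m C.
Hypothesis mw : forall x, I x -> m x = w (pi x).
Hypothesis Cper : forall x (k : int), I x -> C (x + k%:~R * tau) = C x + k%:~R * tau.

Local Notation h := (collapse I m C).
Local Notation blown_map := (blown_map I m C).

Lemma mper x (k : int) : I x -> m (x + k%:~R * tau) = m x.
Proof. by move=> Ix; rewrite !mw ?(ch_per ch)//; exact: (ch_shift ch). Qed.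

Lemma collapse_shift u (k : int) : I u -> h (u + k%:~R * tau) = h u + k%:~R * tau.
Proof.
move=> Iu; have [Ix ux] := collapseP gs Iu.
apply: (collapse_eq gs); first exact: (ch_shift ch).
by rewrite Cper// mper// opprD addrACA subrr addr0.
Qed.

(** The image in [M] of [blown_map sg f u] does not depend on the choice of the lift
[f], nor on that of the preimage [u] of a point of [M]. *)
Lemma blown_map_lift_indep F sg f f' u u' : monotone_bij I sg f -> tame I m f ->
    lifts I pi F f -> lifts I pi F f' -> I u -> I u' -> pi u = pi u' ->
  pi (blown_map sg f u) = pi (blown_map sg f' u').
Proof.
move=> mf tf [fI lf] [f'I lf'] Iu Iu' uu'.
have Ib := blown_map_in gs mf tf Iu.
have [k ku] := ch_inj ch Iu Iu' uu'.
have [Ix ux] := collapseP gs Iu.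
have Ixk := ch_shift ch k Ix.
move: Ib; rewrite ku /blown_map collapse_shift//; set x := h u in Ix ux Ixk * => Ib.
have : pi (f x) = pi (f' (x + k%:~R * tau)) by rewrite lf// lf'// (ch_per ch).
move=> /(ch_inj ch (fI _ Ix) (f'I _ Ixk))[j jx].
rewrite jx mper ?Cper ?mper//; try exact: fI.
by rewrite [in RHS]opprD (addrACA u) subrr addr0 addrAC (ch_per ch).
Qed.

(** The half-lengths of the gaps are the values of a function [w] on [M]; as [pi] is
injective near each point, tameness of a lift of [F] follows from the analogous
property of [F]. *)
Lemma lift_tame F f : lifts I pi F f ->
    (forall p, 0 < w p <-> 0 < w (F p)) ->
    (forall e, 0 < e -> finite_set [set p | 0 < w p /\
      ~ (w p <= (1 + e) * w (F p) /\ w (F p) <= (1 + e) * w p)]) ->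
  tame I m f.
Proof.
move=> [fI lf] wpos wfin.
have tau0 : 0 < tau \/ tau = 0.
  by have := ch_tau ch; rewrite le_eqVlt => /predU1P[|]; [right|left].
split=> [x Ix|x0 e Ix0 e0].
  rewrite (mw Ix) (mw (fI _ Ix)) lf//; have [w1 w2] := wpos (pi x).
  by apply/idP/idP.
pose d := if tau == 0 then 1 else tau / 2.
have d0 : 0 < d.
  by rewrite /d; case: tau0 => [t0|->]; [rewrite gt_eqF// divr_gt0|rewrite eqxx].
exists d => //.
have pinj : {in [set p | I p /\ `|p - x0| < d] &, injective pi}.
  move=> x y /set_mem[Ix xd] /set_mem[Iy yd] /(ch_inj ch Ix Iy)[k ky].
  case: tau0 => [t0|t0]; last by rewrite ky t0 mulr0 addr0.
  have : `|k%:~R * tau| < 1 * tau.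
    rewrite (_ : k%:~R * tau = (y - x0) - (x - x0)); last by rewrite ky; ring.
    apply: le_lt_trans (ler_normB _ _) _.
    by move: xd yd; rewrite /d gt_eqF// => *; lra.
  rewrite normrM (gtr0_norm t0) ltr_pM2r// -intr_norm (ltr_int _ _ 1).
  by move: ky; case: k => [[|n]|n]//= ->; rewrite mul0r addr0.
apply: (@sub_finite_set _ _ ([set p | I p /\ `|p - x0| < d] `&`
    pi @^-1` [set p | 0 < w p /\
      ~ (w p <= (1 + e) * w (F p) /\ w (F p) <= (1 + e) * w p)])).
  move=> p [Ip pd mp nb]; split => //=; rewrite -mw//; split => //.
  by rewrite -lf// -(mw (fI _ Ip)).
set A := (X in finite_set X).
have Ainj : {in A &, injective pi}.
  by move=> x y /set_mem[xB _] /set_mem[yB _]; apply: pinj; exact/mem_set.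
rewrite -(eq_finite_set (inj_card_eq Ainj)).
by apply: sub_finite_set (wfin _ e0) => _ [x [_ px] <-].
Qed.


Section AssembledAction.
Variables (G : groupType) (rho : action M G).
Hypothesis rho_lift : forall g, exists sf : R * (R -> R),
  [/\ monotone_bij I sf.1 sf.2, tame I m sf.2 & lifts I pi (rho g) sf.2].

Lemma blown_map_id u : I u -> blown_map 1 id u = u.
Proof.
move=> Iu; rewrite /blown_map mul1r; have [Ix ux] := collapseP gs Iu.
have := gs_ge0 gs (h u); rewrite le_eqVlt => /predU1P[mx|mx].
  move: ux; rewrite -mx gap_map0 normr_le0 subr_eq0 => /eqP ux.
  by rewrite addr0.
by rewrite gap_map_id// addrC subrK.
Qed.

(** Every action whose elements have tame monotone lifts has a blow-up whose
elements have lifts of class [C1]. *)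
Theorem blown_up_action : exists rho' : action M G, blow_up rho' rho /\
  forall g, exists F D, [/\ forall u, I u -> I (F u),
    forall u, I u -> pi (F u) = rho' g (pi u) & C1_on I F D].
Proof.
have [s sP] := ch_section; have sI p := (sP p).1; have sK p := (sP p).2.
have [L LP] := choice rho_lift.
pose F g := blown_map (L g).1 (L g).2.
have mb g : monotone_bij I (L g).1 (L g).2 by case: (LP g).
have ta g : tame I m (L g).2 by case: (LP g).
have li g : lifts I pi (rho g) (L g).2 by case: (LP g).
have FI g u : I u -> I (F g u) by move=> Iu; apply: (blown_map_in gs).
pose a g p := pi (F g (s p)).
have aF g u : I u -> a g (pi u) = pi (F g u).
  move=> Iu; apply: (blown_map_lift_indep (mb g) (ta g) (li g) (li g)) => //.
have FC g : continuous_on I (F g) by move=> u e Iu e0; exact: blown_map_continuous.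
have ac g : continuous (a g).
  apply: descend_continuous.
  rewrite (_ : a g \o pi = pi \o F g \o r); last first.
    by apply/funext => u /=; rewrite -(ch_pir ch) aF//; exact: (ch_r ch).
  by apply: continuous_on_descend; [exact: FI|exact: FC].
have liM g k : lifts I pi (rho (g * k)%g) ((L g).2 \o (L k).2).
  split=> [x Ix|x Ix] /=; first by apply: (li g).1; apply: (li k).1.
  by rewrite (li g).2 ?(li k).2 ?actM//; apply: (li k).1.
have mbM g k : monotone_bij I ((L g).1 * (L k).1) ((L g).2 \o (L k).2).
  have [s1 f1 u1 m1] := mb g; have [s2 f2 u2 m2] := mb k.
  split=> [|x Ix|y Iy|x y Ix Iy xy] /=.
  - case: s1 => ->; case: s2 => ->; rewrite ?mulN1r ?mul1r ?opprK;
      [left|right|right|left]; exact: erefl.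
  - by apply: f1; apply: f2.
  - by have [z Iz <-] := u1 _ Iy; have [t It <-] := u2 _ Iz; exists t.
  - have := m2 _ _ Ix Iy xy; have Ix' := f2 _ Ix; have Iy' := f2 _ Iy.
    case: s2 => ->; rewrite ?mulr1 ?mul1r ?mulrN1 ?mulN1r ?oppr_gt0 ?subr_gt0 ?subr_lt0.
      exact: m1.
    by move=> /(m1 _ _ Iy' Ix'); rewrite mulNr -mulrN opprB.
have sgM g k : (L (g * k)%g).1 = (L g).1 * (L k).1.
  exact: lift_sign (mb _) (mbM _ _) (li _) (liM _ _).
have aM g k : a (g * k)%g = a g \o a k.
  apply/funext => p; rewrite /= {3}/a aF; last exact: FI.
  rewrite /F (blown_map_comp gs (mb k) (ta k) (mb g) (ta g))// -sgM.
  exact: (blown_map_lift_indep (mb _) (ta _) (li _) (liM _ _)).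
have rho1 : rho 1%g = id by exact: act_one.
(* The sign of the lift of the identity is a square. *)
have a1 : a 1%g = id.
  have sg1 : (L 1%g).1 = 1.
    have := sgM 1%g 1%g; rewrite mulg1; case: (mb_sign (mb 1%g)) => -> //.
    by rewrite mulrNN mulr1.
  have mb1 := mb 1%g; rewrite sg1 in mb1.
  have idl : lifts I pi (rho 1%g) id by split => // x Ix; rewrite rho1.
  apply/funext => p; rewrite /a /F sg1.
  rewrite (blown_map_lift_indep mb1 (ta _) (li _) idl (sI p) (sI p) erefl).
  by rewrite blown_map_id.
have aK g : cancel (a g) (a g^-1%g).
  by move=> p; have := congr1 (@^~ p) (aM g^-1%g g); rewrite mulVg a1.
have aKV g : cancel (a g^-1%g) (a g).
  by move=> p; have := congr1 (@^~ p) (aM g g^-1%g); rewrite mulgV a1.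
have ah g : homeomorphism (a g) by exists (a g^-1%g).
exists (Action ah aM); split; last first.
  move=> g; exists (F g), (fun u => (L g).1 * blown_deriv I m C (L g).2 u); split.
  - exact: FI.
  - by move=> u Iu /=; rewrite aF.
  split=> u e Iu e0; last exact: (blown_map_derivative gs (mb g) (ta g)).
  have [d d0 H] := blown_deriv_continuous gs (ta g) Iu e0.
  exists d => // v Iv /(H v Iv); rewrite -mulrBr normrM.
  by case: (mb_sign (mb g)) => ->; rewrite ?normrN normr1 mul1r.
pose h0 p := pi (h (s p)).
have hI u : I u -> I (h u) by move=> Iu; have [] := collapseP gs Iu.
have h0E u : I u -> h0 (pi u) = pi (h u).
  move=> Iu; have [k ku] := ch_inj ch Iu (sI (pi u)) (esym (sK (pi u))).
  by rewrite /h0 ku collapse_shift// (ch_per ch)//; exact: hI.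
have h0c : continuous h0.
  apply: descend_continuous.
  rewrite (_ : h0 \o pi = pi \o h \o r); last first.
    by apply/funext => u /=; rewrite -(ch_pir ch) h0E//; exact: (ch_r ch).
  apply: continuous_on_descend; first exact: hI.
  by move=> u e Iu e0; exact: collapse_continuous.
have CI x : I x -> I (C x) /\ h (C x) = x.
  move=> Ix; have e : `|C x - C x| <= m x by rewrite subrr normr0 (gs_ge0 gs).
  by split; [exact: (gs_stable gs Ix e)|exact: (collapse_eq gs)].
have h0s q : exists p, h0 p = q.
  have [ICx hCx] := CI _ (sI q); exists (pi (C (s q))).
  by rewrite h0E// hCx sK.
exists h0; split => //.
- by move=> q _; have [p pq] := h0s q; exists p.
- have [K cK piK] := ch_compact ch.
  apply: closed_monotone_connected => //.
    exact: (compact_quotient_closed (ch_cont ch) cK piK (ch_haus ch) h0c).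
  move=> q; have Ix := sI q; set x := s q in Ix.
  rewrite (_ : _ @^-1` _ = pi @` `[C x - m x, C x + m x]%classic); last first.
    apply/seteqP; split => [p /= h0p|_ [u /= + <-]].
      have [k kx] : exists k : int, x = h (s p) + k%:~R * tau.
        by apply: (ch_inj ch) => //; [exact: hI|rewrite /x sK].
      exists (s p + k%:~R * tau); last by rewrite (ch_per ch)// sK.
      have Ik := ch_shift ch k (sI p).
      have [_] := collapseP gs Ik; rewrite collapse_shift// -kx.
      by rewrite /= in_itv/= ler_norml => /andP[? ?]; apply/andP; split; lra.
    rewrite in_itv/= => /andP[? ?].
    have xu : `|u - C x| <= m x by rewrite ler_norml; apply/andP; split; lra.
    by rewrite /= (h0E _ (gs_stable gs Ix xu)) (collapse_eq gs Ix xu) /x sK.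
  apply: connected_continuous_connected; first exact: segment_connected.
  exact/continuous_subspaceT/(ch_cont ch).
- move=> g; apply/funext => p /=.
  rewrite [LHS](h0E _ (FI g _ (sI p))).
  rewrite (collapse_blown_map gs (mb g) (ta g))//.
  by rewrite (li g).2//; exact: hI.
Qed.

End AssembledAction.

End Assembly.

(** * Subexponential growth *)

Section Fekete.
Variables (R : realType) (N : nat -> nat).
Hypotheses (N0 : N 0 = 1%N) (Npos : forall n, (0 < N n)%N).
Hypothesis Nsub : forall m n, (N (m + n) <= N m * N n)%N.

(** [N m <= mu ^ m] for one [m > 0] controls a submultiplicative sequence. *)
Lemma submul_pow_bound (mu : R) m : 1 <= mu -> (0 < m)%N ->
    (N m)%:R <= mu ^+ m ->
  forall n, (N n)%:R <= (N 1)%:R ^+ m * mu ^+ n :> R.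
Proof.
move=> mu1 m0 Nm n.
have Nq q : (N (q * m))%:R <= mu ^+ (q * m) :> R.
  elim: q => [|q IH]; first by rewrite mul0n N0 expr0.
  rewrite mulSn exprD; apply: (@le_trans _ _ ((N m)%:R * (N (q * m))%:R)).
    by rewrite -natrM ler_nat Nsub.
  by apply: ler_pM.
have Nr r : (N r)%:R <= (N 1)%:R ^+ r :> R.
  elim: r => [|r IH]; first by rewrite N0 expr0.
  rewrite exprS; apply: (@le_trans _ _ ((N 1)%:R * (N r)%:R)).
    by rewrite -natrM ler_nat (Nsub 1).
  by apply: ler_pM.
rewrite {1}(divn_eq n m); apply: (@le_trans _ _ ((N (n %/ m * m))%:R * (N (n %% m))%:R)).
  by rewrite -natrM ler_nat Nsub.
rewrite mulrC; apply: ler_pM => //.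
  apply: (le_trans (Nr _)); apply: ler_weXn2l; last by rewrite ltnW// ltn_mod.
  by rewrite (ler_nat _ 1).
apply: (le_trans (Nq _)); apply: ler_weXn2l => //; exact: leq_trunc_div.
Qed.

Let u n : R := (N n)%:R `^ n%:R^-1.

Let NR1 n : 1 <= (N n)%:R :> R. Proof. by rewrite (ler_nat _ 1). Qed.

Let u_ge1 n : 1 <= u n.
Proof.
rewrite /u -[leLHS](powRr0 (N n)%:R); apply: ler_powR; first exact: NR1.
by rewrite invr_ge0.
Qed.

Let u_le (c : R) n : (0 < n)%N -> 0 <= c -> ((N n)%:R <= c ^+ n) = (u n <= c).
Proof.
move=> n0 c0.
have uE : u n ^+ n = (N n)%:R.
  by rewrite -powR_mulrn ?powR_ge0// -powRrM mulVf ?powRr1// pnatr_eq0 -lt0n.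
by rewrite -uE ler_pXn2r// nnegrE// powR_ge0.
Qed.

(** The limit is the infimum of the terms of positive index. *)
Lemma fekete : exists l : R, [/\ u n @[n --> \oo] --> l, 1 <= l &
  forall mu : R, l < mu -> exists2 m, (0 < m)%N & (N m)%:R <= mu ^+ m].
Proof.
pose E := [set u n | n in [set n | (0 < n)%N]].
have infE : has_inf E.
  by split; [exists (u 1); exists 1%N|exists 1 => _ [n _ <-]].
have l1 : 1 <= inf E by apply: lb_le_inf; [case: infE|move=> _ [n _ <-]].
have small mu : inf E < mu -> exists2 m, (0 < m)%N & (N m)%:R <= mu ^+ m.
  move=> lmu; have d0 : 0 < mu - inf E by rewrite subr_gt0.
  have [_ [m m0 <-]] := inf_adherent d0 infE; rewrite addrC subrK => um.
  by exists m => //; rewrite u_le ?ltW//; lra.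
exists (inf E); split => //.
apply/cvgrPdist_le => e e0.
have le_e2 : inf E < inf E + e / 2 by lra.
have [m m0 Nm] := small _ le_e2.
pose mu := inf E + e / 2.
have mu1 : 1 <= mu by rewrite /mu; lra.
have NB := submul_pow_bound mu1 m0 Nm.
pose K : R := (N 1)%:R ^+ m.
have K1 : 1 <= K by rewrite /K exprn_ege1.
have Kcvg : K `^ n%:R^-1 @[n --> \oo] --> (1 : R).
  have Kn0 : K != 0 by rewrite gt_eqF//; lra.
  rewrite (_ : (fun n => K `^ _) = (fun n => expR (n%:R^-1 * ln K))); last first.
    by apply/funext => n; rewrite /powR (negbTE Kn0).
  have : expR (n%:R^-1 * ln K) @[n --> \oo] --> expR (0 * ln K).
    apply: continuous_cvg; first exact: continuous_expR.
    apply: cvgMr_tmp; rewrite -cvg_shiftS; exact: (@cvg_harmonic R).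
  by rewrite mul0r expR0.
have : mu * K `^ n%:R^-1 @[n --> \oo] --> mu * 1 by apply: cvgMl_tmp.
move=> /cvgrPdist_lt/(_ (e / 2)); have e20 : 0 < e / 2 by lra.
move=> /(_ e20) Hn; near=> n.
have n0 : (0 < n)%N by near: n; exists 1%N.
have ul : inf E <= u n.
  by apply: ge_inf; [case: infE|exists n].
rewrite distrC ger0_norm ?subr_ge0// lerBlDr.
have uK : u n <= mu * K `^ n%:R^-1.
  rewrite -u_le ?mulr_ge0 ?powR_ge0//; last lra.
  rewrite exprMn -[X in _ * X]powR_mulrn ?powR_ge0// -powRrM mulVf ?pnatr_eq0 -?lt0n//.
  by rewrite powRr1 1?mulrC//; lra.
have : `|mu * 1 - mu * K `^ n%:R^-1| < e / 2 by near: n.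
by rewrite ltr_norml /mu mulr1 in uK * => /andP[? ?]; lra.
Unshelve. all: by end_near. Qed.

End Fekete.

Section Growth.
Variable G : groupType.
Implicit Type S : {fset G}.

Lemma is_subgroupP (H : set G) :
  is_subgroup H <-> H 1%g /\ forall x y, H x -> H y -> H (x / y)%g.
Proof.
split=> -[H1 H2]; split; first exact: set_mem H1.
- by move=> x y Hx Hy; apply: set_mem; apply: H2; exact: mem_set.
- exact: mem_set.
- by move=> x y Hx Hy; apply: mem_set; apply: H2; exact: set_mem.
Qed.

Lemma generated_is_subgroup S : is_subgroup (generated_subgroup S).
Proof.
apply/is_subgroupP; split; first by move=> A [/is_subgroupP[]].
move=> x y Hx Hy A AS; have [/is_subgroupP[_ AB] _] := AS.
by apply: AB; [exact: Hx|exact: Hy].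
Qed.

Lemma fset_powerS S n z :
  reflect (exists2 s, s \in S &
      exists2 x, x \in fset_power S n & z = (s * x)%g)
    (z \in fset_power S n.+1).
Proof.
apply: (iffP (imfset2P _ _ _ _ _)) => /=.
  by move=> [s sS [x xS ->]]; exists s => //; exists x.
by move=> [s sS [x xS ->]]; exists s => //; exists x.
Qed.

Lemma fset_powerD S m n z : z \in fset_power S (m + n) ->
  exists2 x, x \in fset_power S m & exists2 y, y \in fset_power S n & z = (x * y)%g.
Proof.
elim: m z => [|m IH] z.
  by rewrite add0n => zS; exists 1%g; rewrite ?inE//; exists z; rewrite ?mul1g.
rewrite addSn => /fset_powerS[s sS [x /IH[y yS [t tS ->]] ->]].
exists (s * y)%g; first by apply/fset_powerS; exists s => //; exists y.
by exists t => //; rewrite mulgA.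
Qed.

Lemma card_fset_powerD S m n :
  (#|` fset_power S (m + n)| <= #|` fset_power S m| * #|` fset_power S n|)%N.
Proof.
rewrite -(size_allpairs (fun x y => (x * y)%g)).
apply: uniq_leq_size => [|z /fset_powerD[x xS [y yS ->]]]; first exact: fset_uniq.
by apply/allpairsP; exists (x, y).
Qed.

Lemma fset_power1 S n : 1%g \in S -> 1%g \in fset_power S n.
Proof.
move=> S1; elim: n => [|n IH]; first by rewrite inE.
by apply/fset_powerS; exists 1%g => //; exists 1%g => //; rewrite mulg1.
Qed.

(** By the lemma of Fekete the sequence of the definition of exponential growth
converges, hence its limit is [1]. *)
Lemma subexponential_bound (R : realType) S (mu : R) :
    (forall H : set G, is_subgroup H -> finitely_generated H ->
      ~ exponential_growth R H) ->
    symmetric_fset S -> 1%g \in S -> 1 < mu ->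
  exists2 c : R, 0 < c & forall n, (#|` fset_power S n|)%:R <= c * mu ^+ n.
Proof.
move=> noexp Ssym S1 mu1; pose N n := #|` fset_power S n|.
have N0 : N 0 = 1%N by rewrite /N /= cardfs1.
have Npos n : (0 < N n)%N.
  by rewrite cardfs_gt0; apply/fset0Pn; exists 1%g; exact: fset_power1.
have Nsub m n : (N (m + n) <= N m * N n)%N by exact: card_fset_powerD.
have [l [ul l1 Hl]] := fekete R N0 Npos Nsub.
have lmu : l < mu.
  apply: le_lt_trans mu1; rewrite leNgt; apply/negP => lt1l.
  apply: (noexp _ (generated_is_subgroup S)); first by exists S.
  by exists S; split => //; exists l.
have [m m0 Nm] := Hl _ lmu.
exists ((N 1)%:R ^+ m); first by rewrite exprn_gt0// ltr0n.
exact: (submul_pow_bound N0 Npos Nsub (ltW mu1) m0 Nm).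
Qed.

End Growth.

(** * Slowly varying weights *)

Section Weights.
Variables (R : realType) (T : choiceType) (E : nat -> nat -> seq T).
Hypothesis Ek : forall k k' j, (k <= k')%N -> {subset E k j <= E k' j}.
Hypothesis Ej : forall k j j', (j <= j')%N -> {subset E k j <= E k j'}.
Hypothesis Egrowth : forall k (mu : R), 1 < mu ->
  exists2 c, 0 < c & forall j, (size (E k j))%:R <= c * mu ^+ j.

(** [F] maps stage [j] of the family [E k] to stage [j + 1], for all [k] large. *)
Definition tempered (F : T -> T) : Prop := exists K, forall k, (K <= k)%N ->
  forall j p, p \in E k j -> F p \in E k j.+1.

(** The ratio by which the weights of index [k] decrease from a stage to the next;
it decreases to [1]. *)
Definition rate k : R := 1 + k.+1%:R^-1.

Lemma rate_gt1 k : 1 < rate k.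
Proof. by rewrite /rate ltrDl invr_gt0. Qed.

Lemma rate_gt0 k : 0 < rate k. Proof. exact: lt_trans (rate_gt1 k). Qed.

Lemma rate_decr k k' : (k < k')%N -> rate k' < rate k.
Proof. by move=> kk'; rewrite /rate ltrD2l ltf_pV2 ?posrE// ltr_nat ltnS. Qed.

Lemma geometric_bound (q : R) n : 0 <= q -> q < 1 ->
  \sum_(0 <= j < n) q ^+ j <= (1 - q)^-1.
Proof.
move=> q0 q1; have q10 : 0 < 1 - q by rewrite subr_gt0.
rewrite -[leRHS]mul1r ler_pdivlMr//.
suff -> : (\sum_(0 <= j < n) q ^+ j) * (1 - q) = 1 - q ^+ n.
  by rewrite lerBlDr lerDl exprn_ge0.
elim: n => [|n IH]; first by rewrite big_nil mul0r expr0 subrr.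
by rewrite big_nat_recr//= mulrDl IH exprS; ring.
Qed.

Lemma stage_bound k : exists2 B : R, 0 < B & forall n,
  \sum_(0 <= j < n) (rate k ^- j * (size (E k j))%:R) <= B.
Proof.
(* Any number strictly between [1] and [rate k] would do. *)
pose mu := (1 + rate k) / 2.
have r1 := rate_gt1 k; have r0 := rate_gt0 k.
have mu1 : 1 < mu by rewrite /mu; lra.
have mur : mu / rate k < 1 by rewrite ltr_pdivrMr// /mu; lra.
have [c c0 Hc] := Egrowth k mu1.
have mur0 : 0 <= mu / rate k by rewrite divr_ge0//; lra.
exists (c * (1 - mu / rate k)^-1) => [|n].
  by rewrite mulr_gt0// invr_gt0 subr_gt0.
apply: (@le_trans _ _ (c * \sum_(0 <= j < n) (mu / rate k) ^+ j)); last first.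
  by rewrite ler_wpM2l ?(ltW c0)// geometric_bound.
rewrite mulr_sumr; apply: ler_sum => j _.
rewrite expr_div_n mulrA mulrC; apply: ler_wpM2r => //.
by rewrite invr_ge0 exprn_ge0// ltW.
Qed.

(** Coefficients which make the weights of index [k] of total mass at most
[2 ^ -k]. *)
Lemma stage_coef : exists c : nat -> R, (forall k, 0 < c k) /\ forall k n,
  \sum_(0 <= j < n) (c k * rate k ^- j * (size (E k j))%:R) <= 2^-1 ^+ k.
Proof.
have /choice[B HB] : forall k, exists B : R, 0 < B /\ forall n,
    \sum_(0 <= j < n) (rate k ^- j * (size (E k j))%:R) <= B.
  by move=> k; have [B] := stage_bound k; exists B.
exists (fun k => 2^-1 ^+ k / B k); split => [k|k n].
  by rewrite divr_gt0 ?exprn_gt0//; case: (HB k).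
have [Bk HBk] := HB k.
under eq_bigr do rewrite -mulrA.
rewrite -mulr_sumr -mulrA ler_piMr ?exprn_ge0// mulrC ler_pdivrMr// mul1r.
exact: HBk.
Qed.

(** The weight is [w p = sup {c k * rate k ^ -j : p in E k j}]. *)
Lemma tempered_weight : exists w : T -> R,
  [/\ forall p, 0 <= w p,
      forall p, 0 < w p <-> exists k j, p \in E k j,
      exists B, forall X : seq T, uniq X -> \sum_(p <- X) w p <= B &
      forall F e, tempered F -> 0 < e ->
        finite_set [set p | ~ (w p <= (1 + e) * w (F p))] ].
Proof.
have [c [c0 Hc]] := stage_coef.
pose v k j := c k * rate k ^- j.
have v0 k j : 0 < v k j.
  by rewrite /v mulr_gt0// invr_gt0 exprn_gt0// rate_gt0.
have sumv k n : \sum_(0 <= j < n) v k j * (size (E k j))%:R <= 2^-1 ^+ k.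
  exact: Hc.
pose V p := [set x | exists k j, p \in E k j /\ x = v k j].
have Vle1 p x : V p x -> x <= 1.
  move=> [k [j [pE ->]]]; apply: (@le_trans _ _ (2^-1 ^+ k)); last first.
    by rewrite exprn_ile1//; lra.
  apply: le_trans (sumv k j.+1); rewrite big_nat_recr//=.
  rewrite -[leLHS]add0r; apply: lerD.
    by apply: sumr_ge0 => i _; rewrite mulr_ge0// ltW.
  rewrite ler_peMr ?(ltW (v0 _ _))// (ler_nat _ 1).
  by case: (E k j) pE.
pose w p := sup (V p).
have supV p k j : p \in E k j -> has_sup (V p).
  by move=> pE; split; [exists (v k j), k, j|exists 1 => x /Vle1].
have w_ge p k j : p \in E k j -> v k j <= w p.
  move=> pE; apply: ub_le_sup; first by case: (supV _ _ _ pE).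
  by exists k, j.
have w_le p x : 0 <= x -> (forall k j, p \in E k j -> v k j <= x) -> w p <= x.
  move=> x0 H; have [[y Vy]|nV] := pselect (exists y, V p y).
    by apply: ge_sup => [|_ [k [j [pE ->]]]]; [exists y|exact: H].
  rewrite /w (_ : V p = set0) ?sup0//.
  by rewrite -subset0 => y Vy; apply: nV; exists y.
have wpos p k j : p \in E k j -> 0 < w p.
  by move=> pE; apply: lt_le_trans (w_ge _ _ _ pE).
have w_ge0 p : 0 <= w p.
  have [[k [j pE]]|nE] := pselect (exists k j, p \in E k j).
    exact/ltW/(wpos _ _ _ pE).
  rewrite /w (_ : V p = set0) ?sup0//.
  by rewrite -subset0 => y [k [j [pE _]]]; apply: nE; exists k, j.
have wposE p : 0 < w p <-> exists k j, p \in E k j.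
  split=> [wp|[k [j pE]]]; last exact: wpos pE.
  apply: contrapT => nE; move: wp; rewrite /w (_ : V p = set0) ?sup0 ?ltxx//.
  by rewrite -subset0 => y [k [j [pE _]]]; apply: nE; exists k, j.
exists w; split => //.
- exists 4 => X uX.
  have /choice[kj Hkj] : forall p, exists kj : nat * nat,
      0 < w p -> p \in E kj.1 kj.2 /\ w p <= 2 * v kj.1 kj.2.
    move=> p; have [wp|] := boolP (0 < w p); last by exists (0, 0)%N.
    have [k [j pE]] := (wposE p).1 wp.
    have w2 : 0 < w p / 2 by lra.
    have [_ [k' [j' [pE' ->]]] lt] := sup_adherent w2 (supV _ _ _ pE).
    by exists (k', j') => _; split => //=; rewrite -/(w p) in lt; lra.
  pose N := (\max_(p <- X) maxn (kj p).1 (kj p).2).+1.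
  have kN p : p \in X -> ((kj p).1 < N)%N.
    move=> pX; rewrite ltnS (bigD1_seq p)//=.
    by rewrite !leq_max leqnn.
  have jN p : p \in X -> ((kj p).2 < N)%N.
    move=> pX; rewrite ltnS (bigD1_seq p)//=.
    by rewrite !leq_max leqnn orbT.
  have wX p : p \in X -> w p <= \sum_(0 <= k < N) \sum_(0 <= j < N)
      2 * v k j * (p \in E k j)%:R.
    move=> pX; have t0 k j : 0 <= 2 * v k j * (p \in E k j)%:R.
      by apply: mulr_ge0 => //; apply: mulr_ge0 => //; exact: ltW.
    have [wp|wp] := ltP 0 (w p); last first.
      by apply: (le_trans wp); apply: sumr_ge0 => k _; apply: sumr_ge0 => j _.
    have [pE w2] := Hkj _ wp.
    rewrite (bigD1_seq (kj p).1) ?mem_index_iota ?kN ?iota_uniq//=.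
    rewrite (bigD1_seq (kj p).2) ?mem_index_iota ?jN ?iota_uniq//=.
    rewrite pE mulr1 -addrA; apply: (le_trans w2); rewrite lerDl addr_ge0//.
      by apply: sumr_ge0 => j _.
    by apply: sumr_ge0 => k _; apply: sumr_ge0 => j _.
  rewrite big_seq; apply: (le_trans (ler_sum _ wX)); rewrite -big_seq.
  rewrite exchange_big /=.
  apply: (@le_trans _ _ (\sum_(0 <= k < N) 2 * 2^-1 ^+ k)); last first.
    rewrite -mulr_sumr; have : \sum_(0 <= j < N) (2^-1 : R) ^+ j <= (1 - 2^-1)^-1.
      by apply: geometric_bound => //; rewrite invf_lt1 ?ltr1n.
    rewrite (_ : (1 - 2^-1)^-1 = 2); last by field.
    by move=> ?; lra.
  apply: ler_sum => k _; rewrite exchange_big /=.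
  apply: (@le_trans _ _ (2 * \sum_(0 <= j < N) v k j * (size (E k j))%:R)).
    rewrite mulr_sumr; apply: ler_sum => j _.
    rewrite -mulr_sumr -mulrA ler_pM2l// ler_pM2l//.
    rewrite -natr_sum ler_nat -sum1_size.
    rewrite (_ : (\sum_(p <- X) (p \in E k j) = size [seq p <- X | p \in E k j])%N).
      rewrite sum1_size; apply: uniq_leq_size; first exact: filter_uniq.
      by move=> p; rewrite mem_filter => /andP[].
    by rewrite size_filter -sum1_count [RHS]big_mkcond; apply: eq_bigr => p _; case: (_ \in _).
  by rewrite ler_pM2l// sumv.
- move=> F e [K0 HF] e0.
  have [K KK0 rK] : exists2 K, (K0 <= K)%N & rate K <= 1 + e.
    have [n ne] : exists n, e^-1 <= n%:R.
      by exists (Num.bound e^-1); apply/ltW/archi_boundP; rewrite invr_ge0 ltW.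
    exists (maxn K0 n); first exact: leq_maxl.
    rewrite /rate lerD2l -[leRHS]invrK lef_pV2 ?posrE ?invr_gt0//.
    apply: (le_trans ne); rewrite ler_nat; exact: leq_trans (leq_maxr _ _) _.
  (* Far away, the weights of index less than [K] are dominated by those of
     index [K], which decrease at a slower rate. *)
  have HN k : (k < K)%N -> exists N, forall j, (N <= j)%N -> v k j <= v K j.+1.
    move=> kK.
    have q1 := rate_decr kK; have rK0 := rate_gt0 K; have rk0 := rate_gt0 k.
    have [N HN] : exists N, c k / c K * rate K <= 1 + N%:R * (rate k / rate K - 1).
      have d0 : 0 < rate k / rate K - 1.
        by rewrite subr_gt0 ltr_pdivlMr// mul1r.
      have [n Hn] : exists n, c k / c K * rate K / (rate k / rate K - 1) <= n%:R.
        eexists; apply/ltW/archi_boundP.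
        by rewrite divr_ge0 ?(ltW d0)// mulr_ge0 ?(ltW rK0)// divr_ge0 ?(ltW (c0 _)).
      by exists n; move: Hn; rewrite ler_pdivrMr//; lra.
    exists N => j Nj.
    (* Bernoulli's inequality. *)
    have bern (d : R) n : 0 <= d -> 1 + n%:R * d <= (1 + d) ^+ n.
      move=> d0; elim: n => [|n IH]; first by rewrite mul0r addr0 expr0.
      rewrite exprS -natr1; have n0 : 0 <= n%:R :> R by [].
      have : 0 <= n%:R * d * d by apply: mulr_ge0 => //; exact: mulr_ge0.
      by have := ler_wpM2l (_ : 0 <= 1 + d) IH; rewrite addr_ge0// => /(_ isT); lra.
    have q0 : 0 <= rate k / rate K - 1.
      by rewrite subr_ge0 ler_pdivlMr// mul1r ltW.
    have := bern _ j q0; rewrite [1 + (_ - 1)]addrC subrK => Bj.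
    have : c k / c K * rate K <= (rate k / rate K) ^+ j.
      apply: (le_trans HN); apply: le_trans Bj; rewrite lerD2l ler_wpM2r//.
      by rewrite ler_nat.
    rewrite /v expr_div_n ler_pdivlMr ?exprn_gt0// => H.
    rewrite ler_pdivrMr ?exprn_gt0// mulrAC ler_pdivlMr ?exprn_gt0//.
    rewrite exprS (_ : c k * _ = c K * (c k / c K * rate K * rate K ^+ j)).
      by rewrite ler_pM2l.
    by field; rewrite gt_eqF.
  have [N HNK] : exists N, forall k j, (k < K)%N -> (N <= j)%N -> v k j <= v K j.+1.
    elim: {1 3}K (leqnn K) => [|n IH] nK; first by exists 0%N.
    have [N1 H1] := IH (ltnW nK); have [N2 H2] := HN n nK.
    exists (maxn N1 N2) => k j; rewrite ltnS leq_eqVlt geq_max => /predU1P[->|kn].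
      by case/andP => _; exact: H2.
    by case/andP => + _; exact: H1.
  (* The exceptional points all belong to the stage [N] of some index [k < K]. *)
  apply: (@sub_finite_set _ _ [set` flatten [seq E k N | k <- iota 0 K]]).
    move=> p; apply: contra_notP => /negP pN; apply: w_le.
      by rewrite mulr_ge0//; lra.
    move=> k j pE; have [kK|Kk] := ltnP k K.
      have Nj : (N <= j)%N.
        rewrite leqNgt; apply: contra pN => jN; apply/flatten_mapP.
        by exists k; [rewrite mem_iota|exact: Ej (ltnW jN) _ pE].
      apply: (le_trans (HNK _ _ kK Nj)).
      apply: (@le_trans _ _ (w (F p))); last by rewrite ler_peMl//; lra.
      by apply: w_ge; apply: HF => //; exact: Ek (ltnW kK) _ pE.
    have -> : v k j = rate k * v k j.+1.
      by rewrite /v exprS; field; rewrite !gt_eqF ?exprn_gt0 ?rate_gt0.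
    apply: ler_pM.
    + exact/ltW/rate_gt0.
    + exact/ltW.
    + apply: le_trans rK; have [->//|] := eqVneq k K.
      by move=> kK; apply/ltW/rate_decr; rewrite ltn_neqAle eq_sym kK.
    + by apply: w_ge; apply: HF => //; exact: leq_trans Kk.
  exact: finite_seq.
Qed.

End Weights.

Lemma esum_scale (R : realType) (T : choiceType) (D : set T) (g : T -> R)
    (c A : R) : (forall t, 0 <= g t) -> 0 < c ->
  \esum_(t in D) (g t)%:E = A%:E -> \esum_(t in D) (c * g t)%:E = (c * A)%:E.
Proof.
move=> g0 c0 eA.
have cg0 t : 0 <= c * g t by rewrite mulr_ge0// ltW.
have le1 : (\esum_(t in D) (c * g t)%:E <= (c * A)%:E)%E.
  apply: ge_ereal_sup => _ [X [finX XD] <-].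
  have XA : (\sum_(t \in X) (g t)%:E <= A%:E)%E.
    by rewrite -eA; apply: ereal_sup_ubound; exists X.
  rewrite !fsumEFin// !lee_fin in XA *.
  by rewrite -mulr_fsumr// ler_pM2l.
have fin : \esum_(t in D) (c * g t)%:E \is a fin_num.
  rewrite ge0_fin_numE; first exact: le_lt_trans le1 (ltry _).
  by apply: esum_ge0 => t _; rewrite lee_fin.
have eB := fineK fin; set B := fine _ in eB.
have : A <= c^-1 * B.
  apply: (esum_le_scale cg0 _ _ eB (esym eA)); last by rewrite invr_ge0 ltW.
  by move=> t _; rewrite mulKf// gt_eqF.
rewrite ler_pdivlMl// => cAB; apply/le_anti; rewrite le1/=.
by rewrite -eB lee_fin.
Qed.

Section ActionWeight.
Variables (R : realType) (G : groupType) (M : topologicalType).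
Variable rho : action M G.
Hypothesis G_countable : countable [set: G].
Hypothesis G_growth : forall H : set G,
  is_subgroup H -> finitely_generated H -> ~ exponential_growth R H.
Variable x : nat -> M.

Lemma countable_enum : exists a : nat -> G, forall g, exists n, a n = g.
Proof.
have /countable_injP[f finj] := G_countable.
have /choice[a Ha] : forall n, exists g, forall g', f g' = n -> g = g'.
  move=> n; have [[g fg]|ng] := pselect (exists g, f g = n).
    by exists g => g' fg'; apply: finj; [exact: mem_set|exact: mem_set|rewrite fg fg'].
  by exists 1%g => g' fg'; exfalso; apply: ng; exists g'.
by exists a => g; exists (f g); exact: Ha.
Qed.

Lemma fset_power_sub (S S' : {fset G}) n : {subset S <= S'} ->
  {subset fset_power S n <= fset_power S' n}.
Proof.
move=> SS'; elim: n => [|n IH] z //.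
move=> /fset_powerS[s sS [t tS ->]]; apply/fset_powerS.
by exists s; [exact: SS'|exists t => //; exact: IH].
Qed.

Lemma fset_power_leq (S : {fset G}) n n' : 1%g \in S -> (n <= n')%N ->
  {subset fset_power S n <= fset_power S n'}.
Proof.
move=> S1 /subnK <-; elim: (n' - n)%N => [//|k IH] z zS.
by apply/fset_powerS; exists 1%g => //; exists z; rewrite ?mul1g//; exact: IH.
Qed.

(** [E k j] consists of the images of [x 0], ..., [x k] by the products of [j]
elements of [S k], where [S k] contains [1], the first [k] elements of the group
and their inverses. *)
Theorem action_weight (total : R) : 0 < total -> exists w : M -> R,
  [/\ forall p, 0 <= w p, forall i, 0 < w (x i),
      forall g p, 0 < w p <-> 0 < w (rho g p),
      \esum_(p in [set: M]) (w p)%:E = total%:E &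
      forall g e, 0 < e -> finite_set [set p | 0 < w p /\
        ~ (w p <= (1 + e) * w (rho g p) /\ w (rho g p) <= (1 + e) * w p)]].
Proof.
move=> total0; have [a aS] := countable_enum.
pose S k := [fset g in
  1%g :: flatten [seq [:: a i; (a i)^-1%g] | i <- iota 0 k]]%fset.
have SP k g :
    reflect (g = 1%g \/ exists2 i, (i < k)%N & g = a i \/ g = (a i)^-1%g)
      (g \in S k).
  rewrite !inE; apply: (iffP orP) => [[/eqP|/flatten_mapP[i]]|[->|[i ik gi]]].
  - by left.
  - rewrite mem_iota/= add0n => ik; rewrite !inE => /orP[/eqP gi|/eqP gi].
      by right; exists i => //; left.
    by right; exists i => //; right.
  - by left.
  - right; apply/flatten_mapP; exists i; first by rewrite mem_iota.
    by rewrite !inE; case: gi => ->; rewrite eqxx ?orbT.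
have S1 k : 1%g \in S k by apply/SP; left.
have Ssym k : symmetric_fset (S k).
  move=> g /SP[->|[i ik gi]]; apply/SP; first by left; rewrite invg1.
  by right; exists i => //; case: gi => ->; rewrite ?invgK; [right|left].
have Sk k k' : (k <= k')%N -> {subset S k <= S k'}.
  move=> kk' g /SP[->|[i ik gi]]; apply/SP; first by left.
  by right; exists i => //; exact: leq_trans ik kk'.
pose E k j := [seq rho s (x i) | s <- fset_power (S k) j, i <- iota 0 k.+1].
have EP k j p :
    reflect (exists2 s, s \in fset_power (S k) j &
        exists2 i, (i <= k)%N & p = rho s (x i))
      (p \in E k j).
  apply: (iffP allpairsP) => [[[s i] [sS iS pE]]|[s sS [i ik ->]]].
    exists s => //; exists i => //.
    by move: iS; rewrite mem_iota/= add0n ltnS.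
  by exists (s, i); split => //; rewrite mem_iota/= add0n ltnS.
have Ek k k' j : (k <= k')%N -> {subset E k j <= E k' j}.
  move=> kk' p /EP[s sS [i ik ->]]; apply/EP; exists s.
    exact: fset_power_sub (Sk _ _ kk') _ sS.
  by exists i => //; exact: leq_trans kk'.
have Ej k j j' : (j <= j')%N -> {subset E k j <= E k j'}.
  move=> jj' p /EP[s sS [i ik ->]]; apply/EP; exists s; last by exists i.
  exact: fset_power_leq jj' _ sS.
have Egrowth k (mu : R) : 1 < mu ->
    exists2 c, 0 < c & forall j, (size (E k j))%:R <= c * mu ^+ j.
  move=> mu1; have [c c0 Hc] := subexponential_bound G_growth (Ssym k) (S1 k) mu1.
  exists (c * k.+1%:R) => [|j]; first by rewrite mulr_gt0.
  by rewrite size_allpairs size_iota natrM mulrAC ler_pM2r//.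
have temp g : tempered E (rho g).
  have [n an] := aS g; exists n.+1 => k nk j p /EP[s sS [i ik ->]]; apply/EP.
  exists (g * s)%g; last by exists i => //; rewrite actM.
  by apply/fset_powerS; exists g; [apply/SP; right; exists n => //; left|exists s].
have [w [w0 wE [B HB] wfin]] := tempered_weight Ek Ej Egrowth.
have wx i : 0 < w (x i).
  apply/wE; exists i, 0%N; apply/EP; exists 1%g; first by rewrite inE.
  by exists i => //; rewrite act_one.
have wrho g p : 0 < w p -> 0 < w (rho g p).
  move=> /wE[k [j pE]]; have [K HK] := temp g; apply/wE.
  exists (maxn k K), j.+1; apply: HK; first exact: leq_maxr.
  exact: Ek (leq_maxl _ _) _ pE.
have fin : \esum_(p in [set: M]) (w p)%:E \is a fin_num.
  rewrite ge0_fin_numE; last by apply: esum_ge0 => p _; rewrite lee_fin.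
  apply: (@le_lt_trans _ _ B%:E); last exact: ltry.
  apply: ge_ereal_sup => _ [X [finX _] <-].
  by rewrite fsumEFin// fsbig_finite//= lee_fin; exact: HB.
have eA := esym (fineK fin); set A := fine _ in eA.
have A0 : 0 < A.
  rewrite -lte_fin -eA; apply: (@lt_le_trans _ _ (w (x 0%N))%:E).
    by rewrite lte_fin.
  by apply: esum_ge; exists [set x 0%N]; [split|rewrite fsbig_set1].
pose c := total / A.
have c0 : 0 < c by rewrite divr_gt0.
have cw p q e : (c * w p <= (1 + e) * (c * w q)) = (w p <= (1 + e) * w q).
  by rewrite mulrCA ler_pM2l.
exists (fun p => c * w p); split.
- by move=> p; rewrite mulr_ge0// ltW.
- by move=> i; rewrite mulr_gt0.
- move=> g p; rewrite !(pmulr_rgt0 _ c0); split; first exact: wrho.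
  by move=> /(wrho g^-1%g); rewrite act_invK.
- by rewrite (esum_scale w0 c0 eA) /c divfK// gt_eqF.
- move=> g e e0.
  have f1 := wfin _ _ (temp g) e0.
  have f2 : finite_set (rho g @^-1` [set p | ~ (w p <= (1 + e) * w (rho g^-1%g p))]).
    apply: finite_preimage; last exact: wfin (temp _) e0.
    by move=> p q _ _; exact: (can_inj (act_invK rho g)).
  have f12 : finite_set ([set p | ~ (w p <= (1 + e) * w (rho g p))] `|`
      rho g @^-1` [set p | ~ (w p <= (1 + e) * w (rho g^-1%g p))]).
    by rewrite finite_setU.
  apply: sub_finite_set f12 => p [_]; rewrite !cw => /not_andP[|] H; [left|right] => //.
  by rewrite /= act_invK.
Qed.

End ActionWeight.

(** * The interval *)

Lemma esum_subset (R : realType) (T : choiceType) (A B : set T) (f : T -> \bar R) :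
  A `<=` B -> (\esum_(t in A) f t <= \esum_(t in B) f t)%E.
Proof.
move=> AB; apply: ge_ereal_sup => _ [X [finX XA] <-].
by apply: ereal_sup_ubound; exists X => //; split => // t /XA/AB.
Qed.

Lemma set_type_hausdorff (T : topologicalType) (A : set T) :
  hausdorff_space T -> hausdorff_space A.
Proof.
move=> hT p q pq; apply: val_inj; apply: hT => U V Up Vq.
have nU : nbhs p (set_val @^-1` U) := @initial_continuous A T set_val p U Up.
have nV : nbhs q (set_val @^-1` V) := @initial_continuous A T set_val q V Vq.
by have [r [Ur Vr]] := pq _ _ nU nV; exists (set_val r).
Qed.

(** An enumeration of the rational numbers. *)
Definition rat_seq (R : realType) (n : nat) : R :=
  ratr (odflt 0 (@choice.unpickle rat n)).

Lemma rat_seq_dense (R : realType) (x y : R) : x < y ->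
  exists n, x < rat_seq R n < y.
Proof.
move=> xy; have [q] := rat_in_itvoo xy; rewrite in_itv/= => qxy.
by exists (choice.pickle q); rewrite /rat_seq choice.pickleK.
Qed.

Section Segment.
Variables (R : realType) (a b : R).
Hypothesis ab : a < b.

Local Notation A := (`[a, b]%classic : set R).

(** The projection of the line onto [[a, b]]. *)
Definition clamp x := Num.max a (Num.min x b).

Lemma clamp_itv x : a <= clamp x <= b.
Proof. by rewrite /clamp le_max lexx ge_max (ltW ab) ge_min lexx orbT. Qed.

Lemma clamp_in x : clamp x \in A.
Proof. by apply/mem_set; rewrite /= in_itv/= clamp_itv. Qed.

Lemma clamp_id x : a <= x <= b -> clamp x = x.
Proof. by move=> /andP[ax xb]; rewrite /clamp min_l// max_r. Qed.

Lemma clamp_lip x y : `|clamp x - clamp y| <= `|x - y|.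
Proof.
wlog xy : x y / x <= y.
  move=> W; have /orP[/W//|/W] := le_total x y.
  by rewrite distrC (distrC y).
have cxy : clamp x <= clamp y.
  rewrite /clamp; have := ab; case: (leP x b) => ?; case: (leP y b) => ?;
    case: (leP a x) => ?; case: (leP a y) => ?; case: (leP a b) => ?; lra.
rewrite !ler0_norm ?subr_le0// !opprB lerBlDr [X in X <= _]/clamp ge_max.
have /andP[ax _] := clamp_itv x; apply/andP; split; first lra.
have : Num.min x b <= clamp x by rewrite /clamp le_max lexx orbT.
by case: (leP x b) => xb cx; rewrite ge_min; apply/orP; [left|right]; lra.
Qed.

Definition segment_point x : A := exist (fun u => u \in A) (clamp x) (clamp_in x).

Local Notation pi := segment_point.

Lemma segment_pointK p : pi (set_val p) = p.
Proof.
apply: val_inj => /=; apply: clamp_id.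
by have := set_valP p; rewrite /= in_itv/=.
Qed.

Lemma set_val_segment_point x : A x -> set_val (pi x) = x.
Proof. by rewrite /= in_itv/= => /clamp_id. Qed.

Lemma segment_point_continuous : continuous pi.
Proof.
apply: continuous_comp_initial => x; apply/cvgrPdist_lt => e e0.
apply/nbhs_ballP; exists e => //= y; rewrite /ball/=; exact/le_lt_trans/clamp_lip.
Qed.

Lemma segment_chart : chart A 0 pi clamp.
Proof.
split.
- exact: interval_is_interval.
- by exists a, b; rewrite /= !in_itv/= !lexx (ltW ab).
- exact: lexx.
- exact: segment_point_continuous.
- by move=> u; rewrite /= in_itv/= clamp_itv.
- exact: clamp_lip.
- by move=> u; apply: val_inj; rewrite /= clamp_id// clamp_itv.
- move=> x y Ax Ay /(congr1 set_val); rewrite !set_val_segment_point// => ->.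
  by exists 0; rewrite mulr0 addr0.
- by move=> x k Ax; rewrite mulr0 addr0.
- by move=> x k Ax; rewrite mulr0 addr0.
- exists A; first exact: segment_compact.
  by move=> p; exists (set_val p); [exact: set_valP|exact: segment_pointK].
- by apply: set_type_hausdorff; exact: Rhausdorff.
Qed.

Lemma segment_lift (F : A -> A) : homeomorphism F ->
  exists sf : R * (R -> R), monotone_bij A sf.1 sf.2 /\ lifts A pi F sf.2.
Proof.
move=> [k [FK kF Fc kc]].
pose f x := set_val (F (pi x)).
have fA x : A (f x) by exact: set_valP.
have fc : continuous f.
  move=> x; apply: continuous_comp; last exact: initial_continuous.
  by apply: continuous_comp; [exact: segment_point_continuous|exact: Fc].
have finj : {in `[a, b] &, injective f}.
  move=> x y xA yA /val_inj/(can_inj FK)/(congr1 set_val).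
  by rewrite !set_val_segment_point.
have fsurj y : A y -> exists2 x, A x & f x = y.
  move=> Ay; exists (set_val (k (pi y))); first exact: set_valP.
  by rewrite /f segment_pointK kF set_val_segment_point.
have flift : lifts A pi F f by split => // x Ax; rewrite /f segment_pointK.
have := itv_continuous_inj_mono (continuous_subspaceT fc) finj.
case=> mono; [exists (1, f)|exists (-1, f)]; split => //; split => [|x _|//|x y Ax Ay xy].
- by left.
- exact: fA.
- by rewrite mul1r subr_gt0 mono.
- by right.
- exact: fA.
- by rewrite mulN1r oppr_gt0 subr_lt0 mono.
Qed.

(** A lift of class [C1] gives a map of class [C1], with the one-sided derivatives
at the endpoints. *)
Lemma segment_C1 (F : A -> A) (f D : R -> R) : (forall u, A u -> A (f u)) ->
    (forall u, A u -> pi (f u) = F (pi u)) -> C1_on A f D ->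
  C1_itv F.
Proof.
move=> fA fF [Dc fD].
have FE p : set_val (F p) = f (set_val p).
  have Ap := set_valP p.
  by rewrite -{1}(segment_pointK p) -fF// set_val_segment_point//; exact: fA.
have near_val (p : A) d : 0 < d -> nbhs p [set q : A | `|set_val q - set_val p| < d].
  move=> d0; apply: (@initial_continuous A R set_val p [set y | `|y - set_val p| < d]).
  by apply/nbhs_ballP; exists d => // y; rewrite /ball/= distrC.
exists (fun p => D (set_val p)).
  move=> p U /nbhs_ballP[e /= e0 HU].
  have [d d0 H] := Dc _ _ (set_valP p) e0.
  apply: (@filterS _ _ (nbhs_filter p)) (near_val p d d0) => q qd.
  by apply: HU; rewrite /ball/= distrC; apply: H => //; exact: set_valP.
move=> p U /nbhs_ballP[e /= e0 HU].
have e20 : 0 < e / 2 by lra.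
have [d d0 H] := fD _ _ (set_valP p) e20.
suff : nbhs p [set q : A | q != p ->
  U ((set_val q - set_val p)^-1 * (set_val (F q) - set_val (F p)))] by [].
apply: (@filterS _ _ (nbhs_filter p)) (near_val p d d0) => q qd qp.
apply: HU; apply: (@le_lt_trans _ _ (e / 2)); last lra.
have n0 : set_val q - set_val p != 0.
  by rewrite subr_eq0; apply: contra qp => /eqP/val_inj ->.
have := H _ (set_valP q) qd; rewrite !FE => Hq.
set t := set_val q - set_val p in n0 Hq *.
rewrite /= distrC -[X in `|X|](mulKf n0) normrM normfV ler_pdivrMl ?normr_gt0//.
by rewrite mulrBr mulVKf// (mulrC t) (mulrC `|t|).
Qed.

End Segment.

Section SegmentAction.
Variables (R : realType) (a b : R) (ab : a < b) (G : groupType).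
Local Notation A := (`[a, b]%classic : set R).
Variable rho : action (A : topologicalType) G.
Hypothesis G_countable : countable [set: G].
Hypothesis G_growth : forall H : set G,
  is_subgroup H -> finitely_generated H -> ~ exponential_growth R H.

Local Notation pi := (segment_point ab).

(** The half-length of the gap of [t] is the weight of [t], extended by [0] outside
[[a, b]], and the gaps have total length [b - a]. *)
Theorem segment_blow_up : exists rho' : action (A : topologicalType) G,
  blow_up rho' rho /\
  forall g, exists F D, [/\ forall u, A u -> A (F u),
    forall u, A u -> pi (F u) = rho' g (pi u) & C1_on A F D].
Proof.
have total0 : 0 < (b - a) / 2 by have := ab; lra.
have [w [w0 wx wrho wsum wfin]] :=
  action_weight rho G_countable G_growth (pi \o rat_seq R) total0.
pose m t := if t \in `[a, b] then w (pi t) else 0.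
have m0 t : 0 <= m t by rewrite /m; case: ifP.
have mw t : A t -> m t = w (pi t) by rewrite /m /= => ->.
have ge02 t : (0 <= (2 * m t)%:E)%E by rewrite lee_fin mulr_ge0.
have sumA : \esum_(t in A) (2 * m t)%:E = (b - a)%:E.
  rewrite (@reindex_esum _ A _ [set: A] A set_val); last first.
    split => [p _|p q _ _|t At]; first exact: set_valP.
    - exact: val_inj.
    - by exists (pi t) => //; exact: set_val_segment_point.
  rewrite (eq_esum (b := fun p : A => (2 * w p)%:E)); last first.
    by move=> p _; rewrite mw ?segment_pointK//; exact: set_valP.
  by rewrite (esum_scale w0 _ wsum)//; congr EFin; field.
have sumT : \esum_(t in [set: R]) (2 * m t)%:E = (b - a)%:E.
  rewrite -sumA [RHS]esum_mkcond; apply: eq_esum => t _.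
  case: ifPn => //; rewrite notin_setE /m /= => /negP/negbTE ->.
  by rewrite mulr0.
have mfin x y : (\esum_(t in `[x, y[) (2 * m t)%:E < +oo)%E.
  apply: (@le_lt_trans _ _ (b - a)%:E); last exact: ltry.
  by rewrite -sumT; apply: esum_subset.
have Ac t : A t <-> a <= t <= b by rewrite /= in_itv/=.
have sp : gap_spacing A m (gap_center m a).
  apply: gap_center_spacing => //; first exact: interval_is_interval.
  move=> x y /Ac/andP[ax _] /Ac/andP[_ yb] xy; have [n /andP[xn ny]] := rat_seq_dense xy.
  exists (rat_seq R n); first by rewrite xn.
  by rewrite mw; [exact: wx|apply/Ac; apply/andP; split; lra].
set C := gap_center m a in sp.
have Ca : C a - m a = a by rewrite /C /gap_center gap_left0; ring.
have Cb : C b + m b = b.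
  have -> : C b + m b = a + (gap_mass m a b + 2 * m b).
    by rewrite /C /gap_center /gap_left ifT ?(ltW ab)//; ring.
  suff -> : gap_mass m a b + 2 * m b = b - a by ring.
  apply/EFin_inj; rewrite EFinD gap_massE// -sumA (esumID [set b] A)//.
  have -> : A `&` [set b] = [set b].
    by apply/seteqP; split => t /=; [case|move=> ->; rewrite in_itv/= lexx (ltW ab)].
  have -> : A `&` ~` [set b] = `[a, b[%classic.
    apply/seteqP; split => t /=; rewrite !in_itv/=.
      by move=> [/andP[-> tb] /eqP]; rewrite lt_neqAle tb => ->.
    move=> /andP[-> tb]; rewrite (ltW tb); split => // tE.
    by move: tb; rewrite tE ltxx.
  by rewrite esum_set1// addeC.
have aA : A a by apply/Ac; rewrite lexx (ltW ab).
have bA : A b by apply/Ac; rewrite lexx (ltW ab).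
have gs : gap_system A m C.
  split => //.
    move=> u /Ac/andP[au ub]; apply: (gap_cover sp aA bA); rewrite ?Ca ?Cb//.
  move=> x u Ax; have /Ac/andP[ax xb] := Ax.
  rewrite ler_norml => /andP[u1 u2]; apply/Ac; apply/andP; split.
    have : a <= C x - m x.
      rewrite /C /gap_center addrK /gap_left ax lerDl; exact: gap_mass_ge0.
    lra.
  move: xb; rewrite le_eqVlt => /predU1P[xb|xb]; first by rewrite xb in u2; lra.
  by have := gap_lt sp Ax bA xb; have := m0 b; lra.
apply: (blown_up_action (segment_chart ab) gs mw).
  by move=> x k _; rewrite mulr0 !addr0.
move=> g; have [[sg f] /= [mb lf]] := segment_lift ab (act_homeo rho g).
exists (sg, f); split => //=.
apply: (lift_tame (segment_chart ab) mw lf); first exact: wrho.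
exact: wfin.
Qed.

End SegmentAction.

(** * The circle *)

Section CircleParam.
Variable R : realType.
Local Notation tau := (2 * pi : R).
Local Notation cpt := (@circle_point R).

Lemma tau_gt0 : 0 < tau. Proof. by rewrite mulr_gt0// pi_gt0. Qed.

Lemma cos_sin_periodic (x : R) (k : int) :
  cos (x + k%:~R * tau) = cos x /\ sin (x + k%:~R * tau) = sin x.
Proof.
have tE : tau = pi *+ 2 by rewrite mulr2n; ring.
have pos (y : R) n : cos (y + n%:R * tau) = cos y /\ sin (y + n%:R * tau) = sin y.
  by rewrite mulr_natl tE (periodicn (@cosD2pi R)) (periodicn (@sinD2pi R)).
case: k => n; first exact: pos.
rewrite NegzE rmorphN/= mulNr.
by have [<- <-] := pos (x - n.+1%:R * tau) n.+1; rewrite subrK.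
Qed.

Lemma circle_point_periodic x (k : int) : cpt (x + k%:~R * tau) = cpt x.
Proof. by apply: val_inj; have [/= -> ->] := cos_sin_periodic x k. Qed.

Lemma mod_tau (x : R) : exists k : int, 0 <= x - k%:~R * tau < tau.
Proof.
exists (Num.floor (x / tau)); have := floor_itv (x / tau).
rewrite ler_pdivlMr ?tau_gt0// ltr_pdivrMr ?tau_gt0// intrD mulrDl.
by move=> /andP[? ?]; apply/andP; split; lra.
Qed.

(** By the formula [cos t = 1 - 2 sin^2 (t / 2)]. *)
Lemma cos_eq1 (t : R) : 0 <= t < tau -> cos t = 1 -> t = 0.
Proof.
move=> /andP[t0 tt] ct; apply/eqP/negPn/negP => tn0.
have h : 0 < t / 2 < pi by apply/andP; split; [have : 0 < t by rewrite lt0r tn0|]; lra.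
have := sin_gt0_pi h; have := cos_mulr2n (t / 2).
rewrite (_ : t / 2 *+ 2 = t); last by rewrite mulr2n; field.
rewrite ct cos2sin2 => e s0.
have : 0 < sin (t / 2) ^+ 2 by rewrite exprn_gt0.
by move: e; rewrite mulr2n; lra.
Qed.

Lemma circle_point_inj x y : cpt x = cpt y -> exists k : int, y = x + k%:~R * tau.
Proof.
move=> /(congr1 val)/= [cxy sxy].
have [k ktau] := mod_tau (y - x); exists k.
have : cos (y - x - k%:~R * tau) = 1.
  have [] := cos_sin_periodic (y - x) (- k).
  by rewrite rmorphN/= mulNr => -> _; rewrite cosB -cxy -sxy -!expr2 cos2Dsin2.
by move=> /(cos_eq1 ktau) /eqP; rewrite subr_eq0 subr_eq addrC => /eqP.
Qed.

Lemma circle_point_inj_itv x y : 0 <= x < tau -> 0 <= y < tau ->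
  cpt x = cpt y -> x = y.
Proof.
move=> /andP[x0 xt] /andP[y0 yt] /circle_point_inj[k yx].
have kt : `|k%:~R * tau| < 1 * tau.
  have -> : k%:~R * tau = y - x by rewrite yx; ring.
  by rewrite mul1r ltr_norml; apply/andP; split; lra.
move: kt; rewrite normrM (gtr0_norm tau_gt0) ltr_pM2r ?tau_gt0//.
rewrite -intr_norm (ltr_int _ _ 1).
by move: yx; case: k => [[|n]|n]//= ->; rewrite mul0r addr0.
Qed.

Lemma circle_point_surj (p : @circle R) : exists2 t, 0 <= t < tau & cpt t = p.
Proof.
suff [t tp] : exists t, cpt t = p.
  have [k kt] := mod_tau t; exists (t - k%:~R * tau) => //.
  by rewrite -tp -(circle_point_periodic t (- k)) rmorphN mulNr.
case E : (set_val p) => [x y].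
have xy : x ^+ 2 + y ^+ 2 = 1 by have : circle (set_val p) := set_valP p; rewrite E.
have x1 : -1 <= x <= 1.
  rewrite -ler_norml -(@expr_le1 _ 2)// real_normK ?num_real//.
  by have := sqr_ge0 y; lra.
have sE : sin (acos x) = `|y|.
  rewrite sin_acos// -sqrtr_sqr; congr Num.sqrt; lra.
have cE : cos (acos x) = x by apply: acosK; rewrite in_itv.
have [y0|y0] := leP 0 y.
  by exists (acos x); apply: val_inj; rewrite /= cE sE ger0_norm// -E.
exists (- acos x); apply: val_inj; rewrite /= cosN sinN cE sE.
by rewrite ltr0_norm// opprK -E.
Qed.

Lemma circle_point_continuous : continuous cpt.
Proof.
apply: continuous_comp_initial => x.
exact: (cvg_pair (@continuous_cos R x) (@continuous_sin R x)).
Qed.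

Lemma circle_chart : chart [set: R] tau cpt id.
Proof.
split => //.
- by exists 0, 1.
- exact/ltW/tau_gt0.
- exact: circle_point_continuous.
- by move=> x y _ _; exact: circle_point_inj.
- by move=> x k _; exact: circle_point_periodic.
- exists `[0, tau]%classic; first exact: segment_compact.
  move=> p; have [t /andP[t0 tt] tp] := circle_point_surj p; exists t => //.
  by rewrite /= in_itv/= t0 ltW.
- by apply: set_type_hausdorff; exact: norm_hausdorff.
Qed.

(** A continuous determination of the angle on the circle minus the point
[(1, 0)]. *)
Lemma half_angle (t : R) : 0 < t < tau -> pi - 2 * atan (sin t / (1 - cos t)) = t.
Proof.
move=> /andP[t0 tt]; pose h := t / 2.
have tE : t = h *+ 2 by rewrite mulr2n /h; field.
have h0 : 0 < h < pi by rewrite /h; apply/andP; split; lra.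
have s0 := sin_gt0_pi h0.
have -> : sin t / (1 - cos t) = tan (pi / 2 - h).
  rewrite /tan sinB cosB sin_pihalf cos_pihalf tE sin_mulr2n cos_mulr2n cos2sin2.
  rewrite !mulr2n.
  have -> : 1 - (1 - sin h ^+ 2 + (1 - sin h ^+ 2) - 1) = 2 * sin h ^+ 2 by ring.
  rewrite !mul1r !mul0r subr0 add0r; field.
  by rewrite gt_eqF.
by rewrite tanK ?in_itv/=; [rewrite /h; field|move/andP: h0 => [? ?]; apply/andP; split; lra].
Qed.

End CircleParam.

Section PeriodicExtension.
Variables (R : realType) (tau : R) (psi : R -> R).
Hypotheses (tau0 : 0 < tau) (psi0 : psi 0 = 0).
Hypothesis psi_itv : forall t, 0 <= t < tau -> 0 <= psi t < tau.
Hypothesis psi_surj : forall s, 0 <= s < tau -> exists2 t, 0 <= t < tau & psi t = s.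
Hypothesis psi_mono : forall s t, 0 <= s -> s < t -> t < tau -> psi s < psi t.

(** The number of full turns in [x]. *)
Definition turns (x : R) : int := Num.floor (x / tau).

(** The extension to the line of a function on [[0, tau[], commuting with the
translation by [tau]. *)
Definition periodic_extension x :=
  (turns x)%:~R * tau + psi (x - (turns x)%:~R * tau).

Lemma turns_itv x : 0 <= x - (turns x)%:~R * tau < tau.
Proof.
have := floor_itv (x / tau); rewrite ler_pdivlMr// ltr_pdivrMr// intrD mulrDl.
by rewrite -/(turns x) => /andP[? ?]; apply/andP; split; lra.
Qed.

Lemma turns_eq (k : int) t : 0 <= t < tau -> turns (k%:~R * tau + t) = k.
Proof.
move=> /andP[t0 tt]; apply: floor_def; rewrite ler_pdivlMr// ltr_pdivrMr// intrD mulrDl.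
by apply/andP; split; lra.
Qed.

Lemma periodic_extension_mono x y : x < y ->
  periodic_extension x < periodic_extension y.
Proof.
move=> xy; have := turns_itv x; have := turns_itv y; rewrite /periodic_extension.
have : turns x <= turns y.
  by apply: le_floor; rewrite ler_pM2r ?invr_gt0// ltW.
rewrite le_eqVlt => /predU1P[->|kl] /[dup]yt /andP[y0 y1] /[dup]xt /andP[x0 x1].
  by rewrite ltrD2l; apply: psi_mono => //; lra.
have /andP[px0 px1] := psi_itv xt; have /andP[py0 py1] := psi_itv yt.
have : (turns x)%:~R + 1 <= (turns y)%:~R :> R.
  by rewrite -[1]/(1%:~R) -intrD ler_int lezD1.
by move=> /(ler_wpM2r (ltW tau0)); lra.
Qed.

Lemma periodic_extension_surj y : exists x, periodic_extension x = y.
Proof.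
have [t tI tE] := psi_surj (turns_itv y).
exists ((turns y)%:~R * tau + t); rewrite /periodic_extension turns_eq//.
by rewrite addrAC subrr add0r tE addrC subrK.
Qed.

End PeriodicExtension.

Section CircleLift.
Variable R : realType.
Local Notation tau := (2 * pi : R).
Local Notation cpt := (@circle_point R).
Variables F K : @circle R -> @circle R.
Hypotheses (FK : cancel F K) (KF : cancel K F) (Fc : continuous F).

(** A homeomorphism of the circle induces a homeomorphism from the circle minus
[(1, 0)] onto the circle minus the image of this point, which the angles read as
a homeomorphism [phi] of the open interval from [0] to [2 pi]. *)
Lemma circle_turn : exists (s0 : R) (phi : R -> R),
  [/\ cpt s0 = F (cpt 0),
      forall t, 0 < t < tau -> 0 < phi t < tau,
      forall t, 0 < t < tau -> cpt (s0 + phi t) = F (cpt t),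
      forall s, 0 < s < tau -> exists2 t, 0 < t < tau & phi t = s &
      {in `]0, tau[, continuous phi}].
Proof.
have t0 := tau_gt0 R.
have [s0 _ s0E] := circle_point_surj (F (cpt 0)).
pose X t := (set_val (F (cpt t))).1; pose Y t := (set_val (F (cpt t))).2.
pose num t := Y t * cos s0 - X t * sin s0.
pose den t := 1 - (X t * cos s0 + Y t * sin s0).
pose phi t := pi - 2 * atan (num t / den t).
have angle t : 0 < t < tau -> exists th, [/\ 0 < th < tau, cpt (s0 + th) = F (cpt t),
    num t = sin th & den t = 1 - cos th].
  move=> /andP[tp tt]; have [s _ sE] := circle_point_surj (F (cpt t)).
  have [k /andP[k0 k1]] := mod_tau (s - s0); pose th := s - s0 - k%:~R * tau.
  have cpth : cpt (s0 + th) = F (cpt t).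
    rewrite -sE -(circle_point_periodic s (- k)); congr circle_point.
    by rewrite /th rmorphN; ring.
  have thn0 : th != 0.
    apply/eqP => th0; move: cpth; rewrite th0 addr0 s0E => /(can_inj FK).
    have z1 : 0 <= (0 : R) < tau by rewrite lexx.
    have z2 : 0 <= t < tau by rewrite ltW.
    by move=> /(circle_point_inj_itv z1 z2) t00; move: tp; rewrite -t00 ltxx.
  have XE : X t = cos (s0 + th) by rewrite /X -cpth.
  have YE : Y t = sin (s0 + th) by rewrite /Y -cpth.
  exists th; split => //.
  - by rewrite lt0r thn0 k0.
  - have := cos2Dsin2 s0; rewrite /num XE YE (sinD s0 th) (cosD s0 th) => cs.
    transitivity (sin th * (cos s0 ^+ 2 + sin s0 ^+ 2)); first by ring.
    by rewrite cs mulr1.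
  - have := cos2Dsin2 s0; rewrite /den XE YE (sinD s0 th) (cosD s0 th) => cs.
    transitivity (1 - cos th * (cos s0 ^+ 2 + sin s0 ^+ 2)); first by ring.
    by rewrite cs mulr1.
have phiE t : 0 < t < tau -> 0 < phi t < tau /\ cpt (s0 + phi t) = F (cpt t).
  move=> /angle[th [thI thE nE dE]].
  have -> : phi t = th by rewrite /phi nE dE half_angle.
  by [].
exists s0, phi; split => //.
- by move=> t /phiE[].
- by move=> t /phiE[].
- move=> s /[dup] sI /andP[sp st].
  have [t /andP[tp tt] tE] := circle_point_surj (K (cpt (s0 + s))).
  have tn0 : t != 0.
    apply/eqP => tz; have : cpt (s0 + s) = cpt s0 by rewrite s0E -tz tE KF.
    move=> /circle_point_inj[k ks].
    have /(circle_point_inj_itv _ _) : cpt s = cpt 0.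
      rewrite -(circle_point_periodic s k); congr circle_point; lra.
    move=> H; have s00 : s = 0 by apply: H; rewrite ?lexx// ltW.
    by move: sp; rewrite s00 ltxx.
  have tI : 0 < t < tau by rewrite lt0r tn0 tp.
  exists t => //; have [/andP[p0 p1] pE] := phiE _ tI.
  have : cpt (s0 + phi t) = cpt (s0 + s) by rewrite pE tE KF.
  move=> /circle_point_inj[k ks].
  have : cpt (phi t) = cpt s.
    rewrite -(circle_point_periodic (phi t) k); congr circle_point; lra.
  by move=> e; apply: circle_point_inj_itv e; apply/andP; split=> //; exact: ltW.
- move=> t; rewrite in_itv/= => tI.
  have [th [/andP[th0 th1] _ _ dE]] := angle _ tI.
  have d0 : den t != 0.
    rewrite dE subr_eq0; apply/eqP => /esym/cos_eq1 thz.
    by move: (th0); rewrite thz ?ltxx// (ltW th0) th1.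
  have Gc : {for t, continuous (fun t => set_val (F (cpt t)))}.
    apply: continuous_comp; last exact: initial_continuous.
    by apply: continuous_comp; [exact: circle_point_continuous|exact: Fc].
  have Xc : {for t, continuous X} by apply: continuous_comp Gc _; exact: cvg_fst.
  have Yc : {for t, continuous Y} by apply: continuous_comp Gc _; exact: cvg_snd.
  apply: cvgB; first exact: cvg_cst.
  apply: cvgMl_tmp; apply: (@continuous_comp _ _ _ (fun t => num t / den t) atan);
    last exact: continuous_atan.
  apply: cvgM; last first.
    apply: cvgV => //; apply: cvgB; first exact: cvg_cst.
    by apply: cvgD; apply: cvgMr_tmp.
  by apply: cvgB; apply: cvgMr_tmp.
Qed.

(** The function [phi] of [circle_turn] is monotone; replaced by [2 pi - phi] if it
is decreasing, it extends to an increasing bijection of [[0, 2 pi[] and then to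
the line by periodicity. *)
Lemma circle_lift : exists sf : R * (R -> R),
  monotone_bij [set: R] sf.1 sf.2 /\ lifts [set: R] cpt F sf.2.
Proof.
have t0 := tau_gt0 R.
have [s0 [phi [s0E phiI phiE phiS phic]]] := circle_turn.
have phi_inj : {in `]0, tau[ &, injective phi}.
  move=> x y; rewrite !in_itv/= => xI yI pxy.
  have := congr1 (fun z => cpt (s0 + z)) pxy; rewrite /= !phiE// => /(can_inj FK).
  by apply: circle_point_inj_itv; [case/andP: xI => /ltW -> ->|case/andP: yI => /ltW -> ->].
suff [sg [psi [sgE [psi0 psiI psiS psiM psiE]]]] : exists (sg : R) (psi : R -> R),
    (sg = 1 \/ sg = -1) /\ [/\ psi 0 = 0,
     forall t, 0 < t < tau -> 0 < psi t < tau,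
     forall s, 0 < s < tau -> exists2 t, 0 < t < tau & psi t = s,
     forall s t, 0 < s -> s < t -> t < tau -> psi s < psi t &
     forall t, 0 <= t < tau -> cpt (s0 + sg * psi t) = F (cpt t)].
  have I0 t : 0 <= t < tau -> t = 0 \/ 0 < t < tau.
    by rewrite le_eqVlt => /andP[/predU1P[<- _|-> ->]]; [left|right].
  have psiI' t : 0 <= t < tau -> 0 <= psi t < tau.
    move=> /I0[->|/psiI/andP[/ltW-> ->]//]; by rewrite psi0 lexx.
  have psiS' s : 0 <= s < tau -> exists2 t, 0 <= t < tau & psi t = s.
    move=> /I0[->|/psiS[t /andP[/ltW tp tt] <-]]; last by exists t; rewrite ?tp.
    by exists 0; rewrite ?lexx.
  have psiM' s t : 0 <= s -> s < t -> t < tau -> psi s < psi t.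
    rewrite le_eqVlt => /predU1P[<-|]; last exact: psiM.
    by move=> tp tt; rewrite psi0; have /andP[] := psiI t (introT andP (conj tp tt)).
  pose f x := s0 + sg * periodic_extension tau psi x.
  exists (sg, f); split; split => //=.
  - move=> y _.
    have [x xE] := periodic_extension_surj t0 psiS' (sg * (y - s0)).
    exists x => //; rewrite /f xE mulrA.
    by case: sgE => ->; rewrite ?mulrNN mulr1 mul1r addrC subrK.
  - move=> x y _ _ /(periodic_extension_mono t0 psiI' psiM') pxy.
    rewrite /f opprD addrACA subrr add0r -mulrBr mulrA.
    by case: sgE => ->; rewrite ?mulrNN mulr1 mul1r subr_gt0.
  - move=> x _; rewrite /f /periodic_extension; set k := turns _ _.
    have tI := turns_itv t0 x; rewrite -/k in tI.
    rewrite mulrDr addrCA addrC.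
    have -> : sg * (k%:~R * tau) = (sg * k%:~R) * tau by rewrite (mulrA sg).
    have [k' ->] : exists k' : int, sg * k%:~R = k'%:~R.
      case: sgE => ->; first by exists k; rewrite mul1r.
      by exists (- k); rewrite mulN1r rmorphN.
    rewrite circle_point_periodic psiE//; congr F.
    by rewrite -(circle_point_periodic x (- k)) rmorphN mulNr.
have [mono|mono] := itv_continuous_inj_mono (continuous_subspace_itv phic) phi_inj.
  exists 1, (fun t => if t == 0 then 0 else phi t); split; first by left.
  split.
  - by rewrite eqxx.
  - by move=> t /[dup] /andP[tp _] /phiI; rewrite gt_eqF.
  - move=> s /phiS[t tI <-]; exists t => //.
    by case/andP: tI => tp _; rewrite gt_eqF.
  - move=> s t sp st tt; rewrite !gt_eqF//; last exact: lt_trans st.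
    by rewrite mono// in_itv/= ?sp ?tt ?(lt_trans st tt) ?(lt_trans sp st).
  - move=> t /andP[tp tt]; rewrite mul1r; have [->|tn0] := eqVneq t 0.
      by rewrite addr0.
    by rewrite phiE// lt0r tn0 tp.
exists (-1), (fun t => if t == 0 then 0 else tau - phi t); split; first by right.
split.
- by rewrite eqxx.
- move=> t /[dup] /andP[tp _] /phiI /andP[p0 p1]; rewrite gt_eqF//.
  by apply/andP; split; lra.
- move=> s /andP[sp st]; have [|t tI tE] := phiS (tau - s).
    by apply/andP; split; lra.
  by exists t => //; case/andP: tI => tp _; rewrite gt_eqF// tE; ring.
- move=> s t sp st tt; rewrite !gt_eqF//; last exact: lt_trans st.
  rewrite ltrD2l ltrN2.
  by rewrite mono// in_itv/= ?sp ?tt ?(lt_trans st tt) ?(lt_trans sp st).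
- move=> t /andP[tp tt]; have [->|tn0] := eqVneq t 0.
    by rewrite mulr0 addr0.
  rewrite -phiE; last by rewrite lt0r tn0 tp.
  rewrite -(circle_point_periodic (s0 + phi t) (- 1)); congr circle_point.
  by rewrite mulrN1z; ring.
Qed.

End CircleLift.

Lemma C1_on_is_derive (R : realType) (f D : R -> R) : C1_on [set: R] f D ->
  forall t, is_derive t (1 : R) f (D t).
Proof.
move=> [_ fD] t.
have cv : (fun h => h^-1 *: ((f \o shift t) (h *: (1 : R)) - f t)) @ 0^' --> D t.
  apply/cvgrPdist_le => e e0; have [d d0 H] := fD t e I e0; near=> h.
  have hn0 : h != 0 by near: h; exact: nbhs_dnbhs_neq.
  have hd : `|h| < d by near: h; exact: dnbhs0_lt.
  have := H (h + t) I; rewrite addrK => /(_ hd) Hh.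
  rewrite /= /GRing.scale/= mulr1 distrC -[X in `|X|](mulKf hn0) normrM normfV.
  rewrite ler_pdivrMl ?normr_gt0//.
  by rewrite mulrBr mulVKf// (mulrC h) (mulrC `|h|).
by apply: DeriveDef; [exact: cvgP cv|exact: cvg_lim cv].
Unshelve. all: by end_near. Qed.

Lemma continuous_on_setT (R : realType) (D : R -> R) :
  continuous_on [set: R] D -> continuous D.
Proof.
move=> Dc t; apply/cvgrPdist_lt => e e0; have [d d0 H] := Dc t e I e0.
by apply/nbhs_ballP; exists d => //= v; rewrite /ball/= distrC => vd; rewrite distrC; apply: H.
Qed.

Lemma is_derive_cvg (R : realType) (f : R -> R) (t df : R) :
  is_derive t 1 f df ->
  (fun h => h^-1 *: ((f \o shift t) (h *: (1 : R)) - f t)) @ 0^' --> df.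
Proof. by move=> [H <-]; exact: H. Qed.

Lemma circle_C1 (R : realType) (F : @circle R -> @circle R) (f D : R -> R) :
  (forall u, circle_point (f u) = F (circle_point u)) ->
  C1_on [set: R] f D -> C1_circle F.
Proof.
move=> fF fC1; have fd := C1_on_is_derive fC1.
have Dc := continuous_on_setT fC1.1.
have fc : continuous f.
  move=> t; apply: differentiable_continuous; apply/derivable1_diffP.
  by have [] := fd t.
pose G t : R * R := (cos (f t), sin (f t)).
have GE : (fun t => set_val (F (circle_point t))) = G.
  by apply/funext => t; rewrite -fF.
pose dG t : R * R := (- sin (f t) * D t, cos (f t) * D t).
have cvG t : (fun h => h^-1 *: ((G \o shift t) (h *: (1 : R)) - G t)) @ 0^' --> dG t.
  have d1 : is_derive t 1 (cos \o f) (- sin (f t) * D t).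
    exact: is_derive1_comp (is_derive_cos _) (fd t).
  have d2 : is_derive t 1 (sin \o f) (cos (f t) * D t).
    exact: is_derive1_comp (is_derive_sin _) (fd t).
  exact: cvg_pair (is_derive_cvg d1) (is_derive_cvg d2).
split=> [t|].
  by rewrite GE; exact: cvgP (cvG t).
rewrite GE (_ : derive1 G = dG); last first.
  by apply/funext => t; rewrite derive1E; exact: cvg_lim (cvG t).
move=> t.
have sc : {for t, continuous (fun t => sin (f t))}.
  by apply: continuous_comp; [exact: fc|exact: continuous_sin].
have cc : {for t, continuous (fun t => cos (f t))}.
  by apply: continuous_comp; [exact: fc|exact: continuous_cos].
exact: cvg_pair (cvgM (cvgN sc) (Dc t)) (cvgM cc (Dc t)).
Qed.

Section CircleAction.
Variables (R : realType) (G : groupType).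
Local Notation tau := (2 * pi : R).
Local Notation cpt := (@circle_point R).
Variable rho : action (@circle R : topologicalType) G.
Hypothesis G_countable : countable [set: G].
Hypothesis G_growth : forall H : set G,
  is_subgroup H -> finitely_generated H -> ~ exponential_growth R H.

Lemma circle_point_bij (x : R) : set_bij `[x, x + tau[ [set: @circle R] cpt.
Proof.
split => [//|y z /set_mem /=|p _].
  rewrite in_itv/= => /andP[y1 y2] /set_mem /=; rewrite in_itv/= => /andP[z1 z2].
  move=> /circle_point_inj[k zy].
  have kt : `|k%:~R * tau| < 1 * tau.
    have -> : k%:~R * tau = z - y by rewrite zy; ring.
    by rewrite mul1r ltr_norml; apply/andP; split; lra.
  move: kt; rewrite normrM (gtr0_norm (tau_gt0 R)) ltr_pM2r ?tau_gt0//.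
  rewrite -intr_norm (ltr_int _ _ 1).
  by move: zy; case: k => [[|n]|n]//= ->; rewrite mul0r addr0.
have [t _ tp] := circle_point_surj p.
have [k /andP[k0 k1]] := mod_tau (t - x).
exists (t - k%:~R * tau).
  by rewrite /= in_itv/=; apply/andP; split; lra.
by rewrite -tp -(circle_point_periodic t (- k)) rmorphN mulNr.
Qed.

(** The half-length of the gap of [t] is the weight of the point of angle [t], and
the gaps of a full turn have total length [2 pi]. *)
Theorem circle_blow_up : exists rho' : action (@circle R : topologicalType) G,
  blow_up rho' rho /\
  forall g, exists F D, [/\ forall u, [set: R] u -> [set: R] (F u),
    forall u, [set: R] u -> cpt (F u) = rho' g (cpt u) & C1_on [set: R] F D].
Proof.
have t0 := tau_gt0 R.
have [w [w0 wx wrho wsum wfin]] :=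
  action_weight rho G_countable G_growth (cpt \o rat_seq R) (pi_gt0 R).
pose m t := w (cpt t).
have m0 t : 0 <= m t by exact: w0.
have ge02 t : (0 <= (2 * m t)%:E)%E by rewrite lee_fin mulr_ge0.
have turn x : \esum_(t in `[x, x + tau[) (2 * m t)%:E = tau%:E.
  rewrite -(reindex_esum _ _ _ (fun p => (2 * w p)%:E) (circle_point_bij x)).
  by rewrite (esum_scale w0 _ wsum).
have turnsn x n : \esum_(t in `[x, x + n%:R * tau[) (2 * m t)%:E = (n%:R * tau)%:E.
  elim: n => [|n IH]; first by rewrite !mul0r addr0 set_itvco0 esum_set0.
  have n0 : 0 <= n%:R * tau by rewrite mulr_ge0// ltW.
  have eS : n.+1%:R * tau = n%:R * tau + tau by rewrite -[n.+1%:R]natr1; ring.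
  rewrite eS addrA EFinD -IH -(turn (x + n%:R * tau)).
  rewrite (esumID `[x, x + n%:R * tau[%classic)//; congr (_ + _)%E; congr esum.
    apply/seteqP; split => t /=; first by case.
    by rewrite !in_itv/= => /andP[xt tn]; split; apply/andP; split => //; lra.
  apply/seteqP; split => t /=; rewrite !in_itv/=.
    by move=> [/andP[-> ->]] /negP; rewrite -leNgt => ->.
  move=> /andP[xt ->]; have xt' : x <= t by lra.
  by rewrite xt'; split => //; apply/negP; rewrite -leNgt.
have arch (u : R) : exists n : nat, u <= n%:R * tau.
  exists (Num.bound (`|u| / tau)); rewrite -ler_pdivrMr//.
  apply: (@le_trans _ _ (`|u| / tau)); first by rewrite ler_pM2r ?invr_gt0// ler_norm.
  by apply/ltW/archi_boundP; rewrite divr_ge0// ltW.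
have mfin x y : (\esum_(t in `[x, y[) (2 * m t)%:E < +oo)%E.
  have [n yn] := arch (y - x).
  apply: (@le_lt_trans _ _ (n%:R * tau)%:E); last exact: ltry.
  rewrite -(turnsn x n); apply: esum_subset => t /=; rewrite !in_itv/=.
  by move=> /andP[-> ty]; apply: (lt_le_trans ty); lra.
have sp : gap_spacing [set: R] m (gap_center m 0).
  apply: gap_center_spacing => //.
  move=> x y _ _ xy; have [n xny] := rat_seq_dense xy.
  by exists (rat_seq R n) => //; exact: wx.
set C := gap_center m 0 in sp.
have mper x (k : int) : m (x + k%:~R * tau) = m x.
  by rewrite /m circle_point_periodic.
have Cn x n : C (x + n%:R * tau) = C x + n%:R * tau.
  have nt : x <= x + n%:R * tau by rewrite lerDl mulr_ge0// ltW.
  have := gap_leftB 0 m0 mfin nt.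
  have -> : gap_mass m x (x + n%:R * tau) = n%:R * tau.
    by apply/EFin_inj; rewrite gap_massE// turnsn.
  have -> : C (x + n%:R * tau) = 0 + gap_left m 0 (x + n%:R * tau) + m x.
    by rewrite /C /gap_center; congr (_ + _); exact: mper x n.
  by rewrite /C /gap_center; lra.
have Cper x (k : int) : C (x + k%:~R * tau) = C x + k%:~R * tau.
  case: k => n; first exact: Cn.
  rewrite NegzE rmorphN/= mulNr.
  by have := Cn (x - n.+1%:R * tau) n.+1; rewrite subrK => ->; rewrite addrK.
have C0 : C 0 = m 0 by rewrite /C /gap_center gap_left0 !add0r.
have gs : gap_system [set: R] m C.
  split => // u _.
  have [n un] := arch u; have [n' un'] := arch (- u).
  apply: (gap_cover sp (x0 := (- n'%:Z)%:~R * tau) (x1 := n%:Z%:~R * tau)) => //.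
    have := Cper 0 (- n'%:Z); have := mper 0 (- n'%:Z); rewrite !add0r => -> ->.
    by rewrite C0 rmorphN/= mulNr; lra.
  have := Cper 0 n%:Z; have := mper 0 n%:Z; rewrite !add0r => -> ->.
  by rewrite C0; have := m0 0; lra.
apply: (blown_up_action (circle_chart R) gs (w := w)) => //.
move=> g; have [K [FK KF Fc _]] := act_homeo rho g.
have [[sg f] /= [mb lf]] := circle_lift FK KF Fc.
exists (sg, f); split => //=.
apply: (lift_tame (circle_chart R) (w := w) _ lf) => //.
exact: wfin.
Qed.

End CircleAction.

Theorem corollary1p2 (R : realType) (G : groupType)
    (G_countable : countable [set: G])
    (G_growth : forall H : set G,
      is_subgroup H -> finitely_generated H -> ~ exponential_growth R H)
    (M : one_manifold R) (rho : action (carrier M) G) :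
  exists2 rho_hat : action (carrier M) G,
    C1_action rho_hat & semi_conjugate rho_hat rho.
Proof.
have invK (N : topologicalType) (r : action N G) g :
    cancel (r g) (r g^-1%g) /\ cancel (r g^-1%g) (r g).
  by split; [exact: act_invK|have := act_invK r g^-1%g; rewrite invgK].
case: M rho => [a b ab|] rho.
  have [rho' [bu H]] := segment_blow_up ab rho G_countable G_growth.
  exists rho'; last exact: rst_step.
  have C1g g : C1_itv (rho' g).
    by have [F [D [FI FE FC]]] := H g; exact: (segment_C1 (ab := ab) FI FE FC).
  move=> g; have [K1 K2] := invK _ rho' g.
  by exists (rho' g^-1%g); split; [exact: K1|exact: K2|exact: C1g|exact: C1g].
have [rho' [bu H]] := circle_blow_up rho G_countable G_growth.
exists rho'; last exact: rst_step.
have C1g g : C1_circle (rho' g).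
  by have [F [D [_ FE FC]]] := H g; apply: (circle_C1 _ FC) => u; exact: FE.
move=> g; have [K1 K2] := invK _ rho' g.
by exists (rho' g^-1%g); split; [exact: K1|exact: K2|exact: C1g|exact: C1g].
Qed.
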